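(* Let $\mathbf y=\varpi^\mu w\in W^+$. If $\mu$ is spherical (its stabilizer in $W^v$ is finite), or if $\mu\in Y_{in}=\{\lambda\in Y\mid\langle\lambda,\alpha_i\rangle=0\ \forall i\in I\}$, then $\mathbf y$ has only finitely many co-covers for the affine Bruhat order.
   Context: Kac–Moody root datum $(A,X,Y,(\alpha_i)_{i\in I},(\alpha_i^\vee)_{i\in I})$ with $\langle\alpha_i^\vee,\alpha_j\rangle=a_{i,j}$; simple reflections $r_i(x)=x-\langle\alpha_i^\vee,x\rangle\alpha_i$, $r_i(y)=y-\langle y,\alpha_i\rangle\alpha_i^\vee$; $W^v=\langle r_i\rangle$; $\Phi=W^v\{\alpha_i\}$, $\Phi_+$ positive real roots; coroot $\gamma^\vee=w(\alpha_i^\vee)$, $s_\gamma=wr_iw^{-1}$ for $\gamma=w(\alpha_i)$. $Y^{++}=\{\lambda\mid\langle\lambda,\alpha_i\rangle\ge0\ \forall i\}$, $Y^+=W^v\cdot Y^{++}$. $Y\rtimes W^v$: elements $\varpi^\lambda w$, product $\varpi^\lambda w\cdot\varpi^\mu v=\varpi^{\lambda+w(\mu)}wv$; $W^+=Y^+\rtimes W^v$. Affine roots $\Phi^a=\Phi\times\mathbb Z$, positive if $m>0$ or ($m=0$, $\gamma\in\Phi_+$); action $\varpi^\lambda w\cdot(\gamma,m)=(w\gamma,m+\langle\lambda,w\gamma\rangle)$; $s_{(\gamma,m)}=\varpi^{m\gamma^\vee}s_\gamma$. Affine Bruhat order: reflexive–transitive closure of $s_a\mathbf x<\mathbf x$ for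 $\mathbf x\in W^+$, $a\in\Phi^a_+$ with $\mathbf x^{-1}(a)\notin\Phi^a_+$; a partial order. $\mathbf x$ is a co-cover of $\mathbf y$ if $\mathbf x<\mathbf y$ and no $\mathbf z$ satisfies $\mathbf x<\mathbf z<\mathbf y$. *)

(* Defs.v *)
From HB Require Import structures.
From mathcomp Require Import all_boot all_order all_algebra.
From Stdlib Require Import Relations.
Set Implicit Arguments.
Unset Strict Implicit.
Unset Printing Implicit Defensive.
Import Order.TTheory GRing.Theory Num.Theory.
Local Open Scope ring_scope.

(* X and Y are the dual free Z-modules Z^n (row vectors), with the standard
   perfect pairing <y, x> = sum_k y_k x_k.  Every pair of dual free Z-modules
   of finite rank is isomorphic to this one. *)
Definition pairing (n : nat) (y x : 'rV[int]_n) : int :=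
  \sum_(k < n) y 0 k * x 0 k.

Record KMRootDatum := {
  rk : nat;
  idx : finType;
  sroot : idx -> 'rV[int]_rk;
  scoroot : idx -> 'rV[int]_rk;
  cartan_diag : forall i, pairing (scoroot i) (sroot i) = 2;
  cartan_offdiag : forall i j, i != j -> pairing (scoroot i) (sroot j) <= 0;
  cartan_zero : forall i j,
    pairing (scoroot i) (sroot j) = 0 -> pairing (scoroot j) (sroot i) = 0;
  sroot_free : forall c : idx -> int,
    \sum_i c i *: sroot i = 0 -> forall i, c i = 0
}.

Section KM.
Variable D : KMRootDatum.

Definition Xt := 'rV[int]_(rk D).
Definition Yt := 'rV[int]_(rk D).

Definition rX (i : idx D) (x : Xt) : Xt :=
  x - pairing (scoroot i) x *: sroot i.
Definition rY (i : idx D) (y : Yt) : Yt :=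
  y - pairing y (sroot i) *: scoroot i.

(* elements of W^v are represented by words r_{s_1} ... r_{s_k} *)
Definition word := seq (idx D).
Definition actX (s : word) (x : Xt) : Xt := foldr rX x s.
Definition actY (s : word) (y : Yt) : Yt := foldr rY y s.
Definition weq (s t : word) : Prop :=
  (forall x, actX s x = actX t x) /\ (forall y, actY s y = actY t y).

Definition dominant (lam : Yt) : Prop :=
  forall i, 0 <= pairing lam (sroot i).
Definition inYplus (lam : Yt) : Prop :=
  exists s nu, dominant nu /\ lam = actY s nu.
Definition Yin (lam : Yt) : Prop := forall i, pairing lam (sroot i) = 0.
Definition spherical (lam : Yt) : Prop :=
  exists L : seq word, forall s, actY s lam = lam -> exists2 t, t \in L & weq s t.

Definition is_root (g : Xt) : Prop := exists s i, g = actX s (sroot i).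
Definition is_pos_root (g : Xt) : Prop :=
  is_root g /\ exists c : idx D -> nat, g = \sum_i (c i)%:Z *: sroot i.
Definition pos_aff_root (a : Xt * int) : Prop :=
  is_root a.1 /\ (0 < a.2 \/ (a.2 = 0 /\ is_pos_root a.1)).

(* elements varpi^lam w of Y \rtimes W^v *)
Definition aff := (Yt * word)%type.
Definition aeq (a b : aff) : Prop := a.1 = b.1 /\ weq a.2 b.2.
Definition inWplus (a : aff) : Prop := inYplus a.1.
Definition aff_mul (a b : aff) : aff := (a.1 + actY a.2 b.1, a.2 ++ b.2).
Definition aff_inv (a : aff) : aff := (- actY (rev a.2) a.1, rev a.2).
Definition aff_act (a : aff) (r : Xt * int) : Xt * int :=
  (actX a.2 r.1, r.2 + pairing a.1 (actX a.2 r.1)).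
(* for gamma = v(alpha_i): s_(gamma,m) = varpi^{m gamma^vee} v r_i v^{-1},
   gamma^vee = v(alpha_i^vee) *)
Definition aff_refl (v : word) (i : idx D) (m : int) : aff :=
  (m *: actY v (scoroot i), v ++ i :: rev v).

Definition bstep (z x : aff) : Prop :=
  inWplus x /\ inWplus z /\
  exists (v : word) (i : idx D) (m : int),
    pos_aff_root (actX v (sroot i), m) /\
    ~ pos_aff_root (aff_act (aff_inv x) (actX v (sroot i), m)) /\
    aeq z (aff_mul (aff_refl v i m) x).

Definition ble (z x : aff) : Prop :=
  clos_refl_trans aff (fun a b => aeq a b \/ bstep a b) z x.
Definition blt (z x : aff) : Prop := ble z x /\ ~ aeq z x.
Definition cocover (x y : aff) : Prop :=
  blt x y /\ ~ (exists z, blt x z /\ blt z y).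
Definition finitely_many_cocovers (y : aff) : Prop :=
  exists L : seq aff, forall x, cocover x y -> exists2 x', x' \in L & aeq x x'.

End KM.

(* Main.v *)
Require Import Defs.
From mathcomp Require Import all_boot all_order all_algebra.
From mathcomp Require Import zify ring.
From Stdlib Require Import Relations Classical ClassicalEpsilon.
Set Implicit Arguments.
Unset Strict Implicit.
Unset Printing Implicit Defensive.
Import Order.TTheory GRing.Theory Num.Theory.
Local Open Scope ring_scope.

(* Write y = varpi^mu w with mu = u(nu), nu dominant.  A co-cover of y is some
   s_a y with a = (gamma, m) and 0 <= m <= N = <mu, gamma>, so it suffices to
   bound gamma.  If mu is in Y_in then N = m = 0 and gamma is an inversion of
   w^-1.  If mu is spherical, only finitely many roots have N = 0; when N > 0 the
   root beta = u^-1 gamma is positive, and outside finitely many beta also gamma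
   and w^-1 gamma are positive, so that 0 <= m < N.

   An element strictly between s_a y and y exists as soon as some affine root d,
   with finite part not proportional to gamma, is such that d and -s_a d are both
   positive and both made negative by y^-1: then a chain of three reflections in
   the dihedral group of s_a and s_d leads from y down to s_a y, possibly after
   replacing d by -s_d a finitely many times.  Such a d = (u alpha, n) is available
   whenever s_beta has an inversion alpha <> beta with <beta^vee, alpha> >= 2 such
   that alpha and -s_beta alpha avoid the finite set of positive roots that are
   inverted by u or orthogonal to nu.

   It remains to see that only finitely many beta have at most K such alpha.
   Their number does not decrease along beta -> r_i beta with <beta^vee, alpha_i>
   < 0, and increases if this pairing is <= -2.  By Koenig's lemma, a
   counterexample yields an infinite ascending path whose pairings are eventually
   all -1.  The values <beta_t^vee, alpha_j> on the fired simple roots then take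
   finitely many values, hence recur.  The inversions of s_(beta_t) supported on
   fired simple roots strictly grow, so recurrence forces every beta_t to be
   supported on these; but then roots of the path with the same values satisfy
   <beta_s^vee, beta_t> = 2, which yields unboundedly many alpha. *)

Lemma nat_least (P : nat -> Prop) :
  (exists n, P n) -> exists2 n, P n & forall m, P m -> (n <= m)%N.
Proof.
case=> n Pn; elim/ltn_ind: n Pn => n IHn Pn.
have [[m [Pm mn]]|no] := classic (exists m, P m /\ (m < n)%N); first exact: IHn mn Pm.
by exists n => // m Pm; rewrite leqNgt; apply/negP => mn; apply: no; exists m.
Qed.

(** * Bilinearity of the pairing *)

Section Pairing.
Variable n : nat.
Implicit Types x y : 'rV[int]_n.

Lemma pairingE y x : pairing y x = (y *m x^T) 0 0.
Proof. by rewrite mxE; apply: eq_bigr => k _; rewrite mxE. Qed.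

Lemma pairingDl y y' x : pairing (y + y') x = pairing y x + pairing y' x.
Proof. by rewrite !pairingE mulmxDl mxE. Qed.

Lemma pairingDr y x x' : pairing y (x + x') = pairing y x + pairing y x'.
Proof. by rewrite !pairingE raddfD /= mulmxDr mxE. Qed.

Lemma pairingZl a y x : pairing (a *: y) x = a * pairing y x.
Proof. by rewrite !pairingE -scalemxAl mxE. Qed.

Lemma pairingZr a y x : pairing y (a *: x) = a * pairing y x.
Proof. by rewrite !pairingE linearZ -scalemxAr mxE. Qed.

Lemma pairingNl y x : pairing (- y) x = - pairing y x.
Proof. by rewrite -scaleN1r pairingZl mulN1r. Qed.

Lemma pairingNr y x : pairing y (- x) = - pairing y x.
Proof. by rewrite -scaleN1r pairingZr mulN1r. Qed.

Lemma pairingBl y y' x : pairing (y - y') x = pairing y x - pairing y' x.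
Proof. by rewrite pairingDl pairingNl. Qed.

Lemma pairingBr y x x' : pairing y (x - x') = pairing y x - pairing y x'.
Proof. by rewrite pairingDr pairingNr. Qed.

Lemma pairing0r y : pairing y 0 = 0.
Proof. by rewrite -[0](scale0r 0) pairingZr mul0r. Qed.

Lemma subr_scale2 x : x - (2 : int) *: x = - x.
Proof. by rewrite -{1}[x]scale1r -scalerBl -[1 - 2]/(-1 : int) scaleN1r. Qed.

Lemma pairing_sumr (I : finType) y (F : I -> 'rV[int]_n) :
  pairing y (\sum_i F i) = \sum_i pairing y (F i).
Proof. exact: (big_morph _ (pairingDr y) (pairing0r y)). Qed.

Lemma pairing_injl y y' : (forall x, pairing y x = pairing y' x) -> y = y'.
Proof.
move=> eqyy'; apply/rowP => k; have := eqyy' (delta_mx 0 k).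
by rewrite !pairingE trmx_delta -!colE !mxE.
Qed.

End Pairing.

Definition pairing_lin := (pairingDl, pairingDr, pairingNl, pairingNr, pairingZl, pairingZr).

(** * Words acting on [X] and [Y], reduced words, and the cone of nonnegative combinations of simple
    roots *)

Section Weyl.
Variable D : KMRootDatum.
Implicit Types (s t v z : word D) (i j : idx D) (x g : Xt D) (y h : Yt D).

Lemma rX_lin i a x x' : rX i (a *: x + x') = a *: rX i x + rX i x'.
Proof.
by rewrite /rX !pairing_lin scalerDl scalerBr scalerA addrACA opprD.
Qed.

Lemma rX_adj i y x : pairing (rY i y) x = pairing y (rX i x).
Proof. by rewrite /rX /rY !pairing_lin mulrC. Qed.

Lemma rXK i : involutive (@rX D i).
Proof.
move=> x; rewrite /rX !pairing_lin cartan_diag.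
rewrite mulrC -addrA -opprD -scalerDl.
set p := pairing _ _; have -> : p + (p + - (2 * p)) = 0 by ring.
by rewrite scale0r subr0.
Qed.

Lemma actX_lin s a x x' : actX s (a *: x + x') = a *: actX s x + actX s x'.
Proof. by elim: s => //= i s ->; rewrite rX_lin. Qed.

Lemma actXD s x x' : actX s (x + x') = actX s x + actX s x'.
Proof. by rewrite -[x]scale1r actX_lin !scale1r. Qed.

Lemma actX0 s : actX s 0 = 0 :> Xt D.
Proof. by apply: (addIr (actX s 0)); rewrite -actXD !add0r. Qed.

Lemma actXZ s a x : actX s (a *: x) = a *: actX s x.
Proof. by rewrite -[a *: x]addr0 actX_lin actX0 addr0. Qed.

Lemma actXN s x : actX s (- x) = - actX s x.
Proof. by rewrite -scaleN1r actXZ scaleN1r. Qed.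

Lemma actXB s x x' : actX s (x - x') = actX s x - actX s x'.
Proof. by rewrite actXD actXN. Qed.

Lemma actX_cat s t x : actX (s ++ t) x = actX s (actX t x).
Proof. exact: foldr_cat. Qed.

Lemma actX_rcons s i x : actX (rcons s i) x = actX s (rX i x).
Proof. by rewrite -cats1 actX_cat. Qed.

Lemma actX_revK s : cancel (actX s) (actX (rev s)).
Proof.
elim: s => //= i s IHs x; rewrite rev_cons actX_rcons rXK; exact: IHs.
Qed.

Lemma actX_Krev s : cancel (actX (rev s)) (actX s).
Proof. by move=> x; rewrite -{1}[s]revK actX_revK. Qed.

Lemma actX_inj s : injective (actX s).
Proof. exact: can_inj (actX_revK s). Qed.

Lemma actY_cat s t y : actY (s ++ t) y = actY s (actY t y).
Proof. exact: foldr_cat. Qed.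

Lemma actY_rcons s i y : actY (rcons s i) y = actY s (rY i y).
Proof. by rewrite -cats1 actY_cat. Qed.

Lemma actY_adj s y x : pairing (actY s y) x = pairing y (actX (rev s) x).
Proof.
elim: s y x => //= i s IHs y x; first by rewrite rev_cons actX_rcons rX_adj IHs.
Qed.

Lemma pairing_act s y x : pairing (actY s y) (actX s x) = pairing y x.
Proof. by rewrite actY_adj actX_revK. Qed.

Lemma actY_lin s a y y' : actY s (a *: y + y') = a *: actY s y + actY s y'.
Proof. by apply: pairing_injl => x; rewrite !(actY_adj, pairing_lin). Qed.

Lemma actYD s y y' : actY s (y + y') = actY s y + actY s y'.
Proof. by rewrite -[y]scale1r actY_lin !scale1r. Qed.

Lemma actYZ s a y : actY s (a *: y) = a *: actY s y.
Proof. by apply: pairing_injl => x; rewrite !(actY_adj, pairing_lin). Qed.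

Lemma actYN s y : actY s (- y) = - actY s y.
Proof. by rewrite -scaleN1r actYZ scaleN1r. Qed.

Lemma actY_revK s : cancel (actY s) (actY (rev s)).
Proof.
by move=> y; apply: pairing_injl => x; rewrite !actY_adj revK actX_revK.
Qed.

Lemma actY_Krev s : cancel (actY (rev s)) (actY s).
Proof. by move=> y; rewrite -{1}[s]revK actY_revK. Qed.

Lemma weqX s t : (forall x, actX s x = actX t x) -> weq s t.
Proof.
move=> eqst; split=> // y; apply: pairing_injl => x; rewrite !actY_adj.
congr (pairing _ _); apply: (@actX_inj s).
by rewrite actX_Krev eqst actX_Krev.
Qed.

Lemma weq_refl s : weq s s. Proof. by []. Qed.

Lemma weq_sym s t : weq s t -> weq t s.
Proof. by case=> eX eY; split=> ?. Qed.

Lemma weq_trans s t v : weq s t -> weq t v -> weq s v.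
Proof. by move=> [sX sY] [tX tY]; split=> ?; rewrite ?sX ?sY. Qed.

Lemma weq_cat s s' t t' : weq s s' -> weq t t' -> weq (s ++ t) (s' ++ t').
Proof.
by move=> [sX _] [tX _]; apply: weqX => x; rewrite !actX_cat sX tX.
Qed.

Definition reduced s := forall t, weq t s -> (size s <= size t)%N.

Lemma reduced_ex s : exists2 t, weq t s & reduced t.
Proof.
have [|n [t ts <-] nP] := @nat_least (fun n => exists2 t, weq t s & size t = n).
  by exists (size s), s.
by exists t => // t' t't; apply: nP; exists t' => //; apply: weq_trans ts.
Qed.

Lemma reduced_catl s t : reduced (s ++ t) -> reduced s.
Proof.
move=> red s' s's; have := red (s' ++ t) (weq_cat s's (weq_refl t)).
by rewrite !size_cat leq_add2r.
Qed.

Lemma reduced_catr s t : reduced (s ++ t) -> reduced t.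
Proof.
move=> red t' t't; have := red (s ++ t') (weq_cat (weq_refl s) t't).
by rewrite !size_cat leq_add2l.
Qed.

Lemma reduced_weq s t : weq s t -> size s = size t -> reduced t -> reduced s.
Proof. by move=> st e red v vs; rewrite e; apply: red; apply: weq_trans st. Qed.

Definition nonneg x := exists c : idx D -> nat, x = \sum_i (c i)%:Z *: sroot i.

Lemma nonnegD x x' : nonneg x -> nonneg x' -> nonneg (x + x').
Proof.
case=> c -> [c' ->]; exists (fun i => c i + c' i)%N.
by rewrite -big_split; apply: eq_bigr => i _; rewrite /= PoszD scalerDl.
Qed.

Lemma nonnegZ a x : 0 <= a -> nonneg x -> nonneg (a *: x).
Proof.
case: a => // a _ [c ->]; exists (fun i => a * c i)%N.
by rewrite scaler_sumr; apply: eq_bigr => i _; rewrite PoszM scalerA.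
Qed.

Lemma nonneg_sroot i : nonneg (sroot i).
Proof.
exists (fun j => nat_of_bool (j == i)); rewrite (bigD1 i) //= eqxx scale1r big1 ?addr0 // => j.
by move=> /negbTE->; rewrite scale0r.
Qed.

Lemma sroot_inj (c d : idx D -> int) :
  \sum_i c i *: sroot i = \sum_i d i *: sroot i -> c =1 d.
Proof.
move=> e i; apply/eqP; rewrite -subr_eq0; apply/eqP; apply: (sroot_free (c := fun i => c i - d i)).
apply/eqP; rewrite (eq_bigr (fun i => c i *: sroot i - d i *: sroot i)).
  by rewrite sumrB subr_eq0 e.
by move=> j _; rewrite scalerBl.
Qed.

Lemma nonneg_anti x : nonneg x -> nonneg (- x) -> x = 0.
Proof.
case=> c ex [d ed]; rewrite ex big1 // => i _.
have /sroot_inj e : \sum_i ((c i)%:Z + (d i)%:Z) *: sroot i = \sum_i 0 *: @sroot D i.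
  rewrite (eq_bigr (fun i => (c i)%:Z *: sroot i + (d i)%:Z *: sroot i)); last first.
    by move=> j _; rewrite scalerDl.
  by rewrite big_split /= -ex -ed subrr big1 // => j _; rewrite scale0r.
have -> : (c i)%:Z = 0 by have := e i; lia.
by rewrite scale0r.
Qed.

End Weyl.

(** * Rank two: alternating words and braid relations *)

Section RankTwo.
Variable D : KMRootDatum.
Implicit Types (s t v z : word D) (i j : idx D) (x g : Xt D) (y h : Yt D).

Lemma weq_consK i s : weq (i :: i :: s) s.
Proof. by apply: weqX => x /=; rewrite rXK. Qed.

Lemma weq_rconsK i s : weq (rcons (rcons s i) i) s.
Proof. by apply: weqX => x; rewrite !actX_rcons rXK. Qed.

(** The alternating word of length [q] with last letter [j]; it grows on the left, so its first
    letter depends on the parity of [q]. *)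
Fixpoint altw i j q : word D :=
  if q is q'.+1 then (if odd q' then i else j) :: altw i j q' else [::].

Lemma size_altw i j q : size (altw i j q) = q.
Proof. by elim: q => //= q ->. Qed.

Lemma altw_rcons i j q : altw i j q.+1 = rcons (altw j i q) j.
Proof.
elim: q => [//|q IHq].
rewrite -[LHS]/((if odd q.+1 then i else j) :: altw i j q.+1) IHq /=.
by case: (odd q).
Qed.

Lemma altw_cat i j p m : exists2 s, size s = p & altw i j (p + m) = s ++ altw i j m.
Proof.
elim: p => [|p [s ss e]]; first by exists [::].
by exists ((if odd (p + m) then i else j) :: s); rewrite /= ?ss // e.
Qed.

(** Equal adjacent letters would cancel, so a reduced word in two letters alternates, and its last
    letter is not [i]. *)
Lemma reduced_altw i j z :
  reduced z -> all (pred2 i j) z -> (forall z', z != rcons z' i) -> z = altw i j (size z).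
Proof.
elim: z => //= l z IHz red /andP[lij zij] nend.
have redz : reduced z by apply: (@reduced_catr _ [:: l]).
have zE : z = altw i j (size z).
  apply: IHz => // z'; apply/eqP => e.
  by have /eqP := nend (l :: z'); rewrite e.
rewrite -zE; congr (_ :: _).
case: z => [|k z] in red redz zE zij nend IHz *.
  by case/orP: lij => /eqP e; [have := nend [::]; rewrite e eqxx | rewrite e].
have {zE} /= [kE _] := zE.
have lk : l != k.
  apply/eqP => e; have := red z; rewrite e => /(_ (weq_sym (weq_consK k z))) /=; lia.
move: lk lij; rewrite {}kE /=.
case: (odd (size z)) => /= /negbTE lk /orP[] /eqP e; rewrite e ?eqxx // in lk *.
Qed.

Section Pair.
Variables (i j : idx D).
Variables (A B : int).
Hypothesis eA : pairing (scoroot i) (sroot j) = - A.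
Hypothesis eB : pairing (scoroot j) (sroot i) = - B.

Lemma rX_pairl x a b :
  rX i (x + (a *: sroot i + b *: sroot j)) =
  x + ((A * b - a - pairing (scoroot i) x) *: sroot i + b *: sroot j).
Proof.
rewrite /rX !pairing_lin cartan_diag eA -addrA; congr (_ + _).
rewrite addrAC -scalerBl; congr (_ *: _ + _); ring.
Qed.

Lemma rX_pairr x a b :
  rX j (x + (a *: sroot i + b *: sroot j)) =
  x + (a *: sroot i + (B * a - b - pairing (scoroot j) x) *: sroot j).
Proof.
rewrite /rX !pairing_lin cartan_diag eB -addrA; congr (_ + _).
rewrite -addrA -scalerBl; congr (_ + _ *: _); ring.
Qed.

(** The last conjunct is the induction invariant: as [A * B >= 4], it gives [2 * a <= A * b] (or
    [2 * b <= B * a]) for the coefficient reflected next, which therefore stays nonnegative. *)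
Lemma actX_altw_infinite q : 4 <= A * B -> 0 <= A -> 0 <= B ->
  exists a b : int, [/\ 0 <= a, 0 <= b,
    actX (altw i j q) (sroot i) = a *: sroot i + b *: sroot j &
    if odd q then B * a <= 2 * b else A * b <= 2 * a].
Proof.
move=> AB A0 B0; elim: q => [|q [a [b [a0 b0 /= -> H]]]].
  by exists 1, 0; split=> //=; rewrite ?scale1r ?scale0r ?addr0 ?mulr0.
case: (odd q) H => /= H.
  have H2 : 2 * a <= A * b.
    have := ler_wpM2l A0 H; have := ler_wpM2r a0 AB; rewrite !mulrA [A * 2]mulrC; lia.
  exists (A * b - a), b; rewrite -[X in rX i X]add0r rX_pairl pairing0r subr0 add0r.
  by split=> //; lia.
have H2 : 2 * b <= B * a.
  have := ler_wpM2l B0 H; have := ler_wpM2r b0 AB; rewrite !mulrA [B * 2]mulrC [B * A]mulrC; lia.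
exists a, (B * a - b); rewrite -[X in rX j X]add0r rX_pairr pairing0r subr0 add0r.
by split=> //; lia.
Qed.

Definition braid m := weq (altw i j m) (altw j i m) /\
    forall q, (q < m)%N -> exists a b : int, [/\ 0 <= a, 0 <= b &
    actX (altw i j q) (sroot i) = a *: sroot i + b *: sroot j].

(** The zero combination brings [x] into the shape rewritten by [rX_pairl] and [rX_pairr], so that a
    braid relation becomes two polynomial identities in the coefficients. *)
Lemma weq_start w1 w2 : (forall x, actX w1 (x + (0 *: sroot i + 0 *: sroot j)) =
    actX w2 (x + (0 *: sroot i + 0 *: sroot j))) -> weq w1 w2.
Proof. by move=> H; apply: weqX => x; have := H x; rewrite !scale0r !addr0. Qed.

Lemma actX_altw_start q (a b : int) : 0 <= a -> 0 <= b ->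
    actX (altw i j q) (0 + (1 *: sroot i + 0 *: sroot j)) = 0 + (a *: sroot i + b *: sroot j) ->
  exists a b : int, [/\ 0 <= a, 0 <= b & actX (altw i j q) (sroot i) = a *: sroot i + b *: sroot j].
Proof. by rewrite scale1r scale0r addr0 !add0r => a0 b0 e; exists a, b. Qed.

Lemma pair_congr (u : Xt D) (a a' b b' : int) : a = a' -> b = b' ->
  u + (a *: sroot i + b *: sroot j) = u + (a' *: sroot i + b' *: sroot j).
Proof. by move=> -> ->. Qed.

Ltac braid_weq A0 B0 := let x := fresh "x" in apply: weq_start => x /=;
  rewrite !(rX_pairl, rX_pairr) A0 B0;
  move: (pairing (scoroot i) x) (pairing (scoroot j) x) => f g;
  apply: pair_congr; ring.
Ltac braid_pos A0 B0 a b := apply: (@actX_altw_start _ a b) => //=;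
  rewrite ?(rX_pairl, rX_pairr) ?pairing0r ?A0 ?B0; apply: pair_congr; ring.

Lemma braidA1A1 : A = 0 -> B = 0 -> braid 2.
Proof.
move=> A0 B0; split; first by braid_weq A0 B0.
case=> [|[|]] // _.
- by braid_pos A0 B0 (1:int) (0:int).
- by braid_pos A0 B0 (1:int) (0:int).
Qed.

Lemma braidA2 : A = 1 -> B = 1 -> braid 3.
Proof.
move=> A0 B0; split; first by braid_weq A0 B0.
case=> [|[|[|]]] // _.
- by braid_pos A0 B0 (1:int) (0:int).
- by braid_pos A0 B0 (1:int) (1:int).
- by braid_pos A0 B0 (0:int) (1:int).
Qed.

Lemma braidB2 : A = 1 -> B = 2 -> braid 4.
Proof.
move=> A0 B0; split; first by braid_weq A0 B0.
case=> [|[|[|[|]]]] // _.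
- by braid_pos A0 B0 (1:int) (0:int).
- by braid_pos A0 B0 (1:int) (2:int).
- by braid_pos A0 B0 (1:int) (2:int).
- by braid_pos A0 B0 (1:int) (0:int).
Qed.

Lemma braidC2 : A = 2 -> B = 1 -> braid 4.
Proof.
move=> A0 B0; split; first by braid_weq A0 B0.
case=> [|[|[|[|]]]] // _.
- by braid_pos A0 B0 (1:int) (0:int).
- by braid_pos A0 B0 (1:int) (1:int).
- by braid_pos A0 B0 (1:int) (1:int).
- by braid_pos A0 B0 (1:int) (0:int).
Qed.

Lemma braidG2 : A = 1 -> B = 3 -> braid 6.
Proof.
move=> A0 B0; split; first by braid_weq A0 B0.
case=> [|[|[|[|[|[|]]]]]] // _.
- by braid_pos A0 B0 (1:int) (0:int).
- by braid_pos A0 B0 (1:int) (3:int).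
- by braid_pos A0 B0 (2:int) (3:int).
- by braid_pos A0 B0 (2:int) (3:int).
- by braid_pos A0 B0 (1:int) (3:int).
- by braid_pos A0 B0 (1:int) (0:int).
Qed.

Lemma braidG2' : A = 3 -> B = 1 -> braid 6.
Proof.
move=> A0 B0; split; first by braid_weq A0 B0.
case=> [|[|[|[|[|[|]]]]]] // _.
- by braid_pos A0 B0 (1:int) (0:int).
- by braid_pos A0 B0 (1:int) (1:int).
- by braid_pos A0 B0 (2:int) (1:int).
- by braid_pos A0 B0 (2:int) (1:int).
- by braid_pos A0 B0 (1:int) (1:int).
- by braid_pos A0 B0 (1:int) (0:int).
Qed.

(** If [A * B < 4], the Cartan matrix is of type A1 x A1, A2, B2 or G2, up to transposition. *)
Lemma rank2_cases : 0 <= A -> 0 <= B -> (A = 0 -> B = 0) -> (B = 0 -> A = 0) ->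
  4 <= A * B \/ exists2 m, (0 < m)%N & braid m.
Proof.
move=> A_ge0 B_ge0 A0B B0A.
have [?|ltAB] := lerP 4 (A * B); [by left | right].
have [B0|B_neq0] := eqVneq B 0; first by exists 2 => //; apply: braidA1A1 (B0A B0) B0.
have [A0|A_neq0] := eqVneq A 0; first by rewrite A0B ?eqxx in B_neq0.
have [A1|[A2|A3]] : A = 1 \/ A = 2 \/ A = 3 by nia.
- have [B1|[B2|B3]] : B = 1 \/ B = 2 \/ B = 3 by nia.
  + by exists 3 => //; apply: braidA2.
  + by exists 4 => //; apply: braidB2.
  + by exists 6 => //; apply: braidG2.
- have B1 : B = 1 by nia.
  by exists 4 => //; apply: braidC2.
- have B1 : B = 1 by nia.
  by exists 6 => //; apply: braidG2'.
Qed.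

End Pair.

(** By the minimality hypothesis [z] alternates and ends in [j]. If [z] were at least as long as the
    braid relation, that relation would replace its tail by one ending in [i], and [rcons z i] would
    have a shorter expression. *)
Lemma rank2_nonneg i j z : i != j -> reduced z -> all (pred2 i j) z ->
  (forall t, weq t (rcons z i) -> size z <= size t)%N ->
  exists a b : int, [/\ 0 <= a, 0 <= b &
    actX z (sroot i) = a *: sroot i + b *: sroot j].
Proof.
move=> ij red zij zi.
have zE : z = altw i j (size z).
  apply: reduced_altw => // z'; apply/eqP => e.
  have := zi z'; rewrite e => /(_ (weq_sym (weq_rconsK i z'))).
  by rewrite size_rcons ltnn.
have ji : j != i by rewrite eq_sym.
have := @rank2_cases i j (- pairing (scoroot i) (sroot j)) (- pairing (scoroot j) (sroot i))
  (esym (opprK _)) (esym (opprK _)).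
rewrite !oppr_ge0 !cartan_offdiag // => /(_ isT isT).
case.
- by move=> /eqP; rewrite oppr_eq0 => /eqP /cartan_zero ->; rewrite oppr0.
- by move=> /eqP; rewrite oppr_eq0 => /eqP /cartan_zero ->; rewrite oppr0.
- move=> AB; have [||a [b [a0 b0 e _]]] := @actX_altw_infinite i j _ _
    (esym (opprK _)) (esym (opprK _)) (size z) AB; rewrite ?oppr_ge0 ?cartan_offdiag //.
  by exists a, b; rewrite zE.
case=> m m0 [bw bpos]; have [lt_zm|le_mz] := ltnP (size z) m.
  by rewrite zE; apply: bpos.
have [s ss e] := altw_cat i j (size z - m) m.
rewrite subnK // -zE in e.
case: m m0 => // m _ in bw bpos le_mz ss e *.
have := zi (s ++ altw i j m).
have -> : (size (s ++ altw i j m) = (size z).-1)%N by rewrite size_cat ss size_altw; lia.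
have z_gt0 : (0 < size z)%N by lia.
have: (~~ (size z <= (size z).-1))%N by lia.
move=> /negP nle H; case: nle; apply: H.
rewrite e; apply: weqX => x; rewrite actX_rcons !actX_cat.
by rewrite (proj1 bw) altw_rcons actX_rcons rXK.
Qed.
End RankTwo.

(** * Every real root is positive or negative *)

Section Roots.
Variable D : KMRootDatum.
Implicit Types (s t v w z : word D) (i j : idx D) (x g : Xt D) (y h : Yt D).

(* As for Coxeter groups (Humphreys, 5.4): factor [s] as [v ++ z] with [z] in the
   rank two subgroup of [i] and the last letter of [s], and [v] of least length;
   induction applies to [v] and the rank two case to [z]. *)
Lemma reduced_nonneg s i : reduced s ->
  (forall t, weq t (rcons s i) -> (size s <= size t)%N) -> nonneg (actX s (sroot i)).
Proof.
have [n] := ubnP (size s); elim: n => // n IHn in s i *.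
case/lastP: s => [|s' j] lt_n red si; first exact: nonneg_sroot.
have ij : i != j.
  apply/eqP => e; rewrite e in si.
  by have := si _ (weq_sym (weq_rconsK j s')); rewrite size_rcons ltnn.
set s := rcons s' j in lt_n red si *.
have [|_ [v [z [vz svz zij <-]]] vmin] := @nat_least (fun n => exists v z,
    [/\ weq (v ++ z) s, (size v + size z = size s)%N, all (pred2 i j) z & size v = n]).
  exists (size s'), s', [:: j]; rewrite cats1 size_rcons addn1.
  by split=> //=; rewrite eqxx orbT.
have redvz : reduced (v ++ z) by apply: reduced_weq red; rewrite ?size_cat.
have lt_vn : (size v < n)%N.
  have : (size v <= size s')%N.
    apply: vmin; exists s', [:: j]; rewrite cats1 size_rcons addn1.
    by split=> //=; rewrite eqxx orbT.
  by move: lt_n; rewrite size_rcons; lia.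
(* If [rcons v l] had an expression [t] shorter than [v], then [t ++ l :: z] would be a
   factorization of [s] contradicting the minimality of [v]. *)
have vpos l : pred2 i j l -> nonneg (actX v (sroot l)).
  move=> lij; apply: IHn (reduced_catl redvz) _ => // t tv.
  rewrite leqNgt; apply/negP => lt_tv.
  have tz : weq (t ++ l :: z) s.
    apply: weq_trans vz; apply: weqX => x.
    by rewrite !actX_cat (proj1 tv) actX_rcons /= rXK.
  have := red _ tz; rewrite size_cat /= => le_s.
  have := vmin (size t); rewrite leqNgt lt_tv; case/(_ _)/notF.
  exists t, (l :: z); split=> //=; first by lia.
  by rewrite zij andbT; exact: lij.
have [|a [b [a0 b0 e]]] := @rank2_nonneg D i j z ij (reduced_catr redvz) zij.
  move=> t tz; have := si (v ++ t); rewrite size_cat -svz leq_add2l; apply.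
  apply: weqX => x; rewrite actX_cat (proj1 tz) actX_rcons [RHS]actX_rcons.
  by rewrite -(proj1 vz) actX_cat.
rewrite -(proj1 vz) actX_cat e actXD !actXZ.
by apply: nonnegD; apply: nonnegZ => //; apply: vpos; rewrite /= eqxx ?orbT.
Qed.

(** If appending [i] shortens the reduced word, [reduced_nonneg] applies to a reduced form [t] of
    the shortened element, and [s(alpha_i) = - t(alpha_i)]. *)
Lemma root_nonneg_or s i : nonneg (actX s (sroot i)) \/ nonneg (- actX s (sroot i)).
Proof.
have [s' s's red] := reduced_ex s; rewrite -(proj1 s's).
have [H|] := classic (forall t, weq t (rcons s' i) -> (size s' <= size t)%N).
  by left; apply: reduced_nonneg.
move=> /not_all_ex_not[t0 H0]; have [t0s' /negP] := imply_to_and _ _ H0.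
rewrite -ltnNge => lt_t0.
right; have [t tt0 redt] := reduced_ex t0.
have ts' := weq_trans tt0 t0s'.
suff : nonneg (actX t (sroot i)).
  rewrite (proj1 ts') actX_rcons {1}/rX cartan_diag.
  by rewrite subr_scale2 actXN.
apply: (reduced_nonneg redt) => t' t't.
have : weq (rcons t i) s'.
  apply: weqX => x; rewrite !actX_rcons (proj1 ts') actX_rcons rXK //.
move=> ti; have := red t' (weq_trans t't ti).
have := redt t0 (weq_sym tt0); lia.
Qed.

(** A nonempty reduced word makes the simple root of its last letter negative. *)
Lemma weq_nil s : (forall i, nonneg (actX s (sroot i))) -> weq s [::].
Proof.
have [s' s's red] := reduced_ex s => pos.
apply: weq_trans (weq_sym s's) _; case/lastP: s' => // t i in s's red *.
have : nonneg (actX t (sroot i)).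
  apply: reduced_nonneg; first by apply: (@reduced_catl _ t [:: i]); rewrite cats1.
  by move=> t' /red; rewrite size_rcons; lia.
have := pos i; rewrite -(proj1 s's) actX_rcons {1}/rX cartan_diag.
rewrite subr_scale2 actXN => n1 n2.
have t0 := nonneg_anti n2 n1.
have r0 : sroot i = 0 by apply: (@actX_inj _ t); rewrite t0 actX0.
by have := cartan_diag i; rewrite r0 pairing0r.
Qed.

End Roots.

(** * Coordinates in the root lattice, pairs of a root and its coroot, inversions *)

Section RootPairs.
Variable D : KMRootDatum.
Implicit Types (s t v w z : word D) (i j : idx D) (x g : Xt D) (y h : Yt D).

Definition inQ x := exists c : idx D -> int, x = \sum_i c i *: sroot i.

(** Meaningful on the root lattice only; the value elsewhere is unspecified. *)
Definition rcoef x : idx D -> int :=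
  epsilon (inhabits (fun=> 0)) (fun c => x = \sum_i c i *: sroot i).

Lemma rcoefE x : inQ x -> x = \sum_i rcoef x i *: sroot i.
Proof. exact: epsilon_spec. Qed.

Lemma rcoef_sum (c : idx D -> int) : rcoef (\sum_i c i *: sroot i) =1 c.
Proof. by move=> i; symmetry; apply: sroot_inj i; apply: rcoefE; exists c. Qed.

Lemma rcoef_lin a x x' i : inQ x -> inQ x' -> rcoef (a *: x + x') i = a * rcoef x i + rcoef x' i.
Proof.
move=> [c ->] [c' ->].
rewrite scaler_sumr -big_split /= !rcoef_sum.
rewrite (eq_bigr (fun i => (a * c i + c' i) *: sroot i)) ?rcoef_sum //.
by move=> k _; rewrite scalerA scalerDl.
Qed.

Lemma inQ_lin a x x' : inQ x -> inQ x' -> inQ (a *: x + x').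
Proof.
move=> [c ->] [c' ->]; exists (fun i => a * c i + c' i).
rewrite scaler_sumr -big_split /=; apply: eq_bigr => k _.
by rewrite scalerA scalerDl.
Qed.

Lemma inQ0 : inQ 0.
Proof. by exists (fun=> 0); rewrite big1 // => i _; rewrite scale0r. Qed.

Lemma rcoef0 i : rcoef 0 i = 0.
Proof.
have := rcoef_sum (fun=> 0) i; rewrite big1 // => j _; exact: scale0r.
Qed.

Lemma inQD x x' : inQ x -> inQ x' -> inQ (x + x').
Proof. by rewrite -{2}[x]scale1r; apply: inQ_lin. Qed.

Lemma inQZ a x : inQ x -> inQ (a *: x).
Proof. by rewrite -[a *: x]addr0 => /inQ_lin; apply; exact: inQ0. Qed.

Lemma inQN x : inQ x -> inQ (- x).
Proof. by rewrite -scaleN1r; apply: inQZ. Qed.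

Lemma inQB x x' : inQ x -> inQ x' -> inQ (x - x').
Proof. by move=> ? /inQN; apply: inQD. Qed.

Lemma rcoefD x x' i : inQ x -> inQ x' -> rcoef (x + x') i = rcoef x i + rcoef x' i.
Proof. by move=> Qx Qx'; rewrite -[x]scale1r rcoef_lin // scale1r mul1r. Qed.

Lemma rcoefZ a x i : inQ x -> rcoef (a *: x) i = a * rcoef x i.
Proof. by move=> Qx; rewrite -[a *: x]addr0 rcoef_lin ?rcoef0 ?addr0 //; exact: inQ0. Qed.

Lemma rcoefN x i : inQ x -> rcoef (- x) i = - rcoef x i.
Proof. by move=> Qx; rewrite -scaleN1r rcoefZ // mulN1r. Qed.

Lemma rcoefB x x' i : inQ x -> inQ x' -> rcoef (x - x') i = rcoef x i - rcoef x' i.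
Proof. by move=> Qx Qx'; rewrite rcoefD ?rcoefN //; exact: inQN. Qed.

Lemma sroot_sum i : sroot i = \sum_j ((i == j)%:Z : int) *: sroot j.
Proof.
rewrite (bigD1 i) //= eqxx scale1r big1 ?addr0 // => j.
by rewrite eq_sym => /negbTE->; rewrite scale0r.
Qed.

Lemma inQ_sroot i : inQ (sroot i).
Proof. by rewrite sroot_sum; eexists. Qed.

Lemma rcoef_sroot i j : rcoef (sroot i) j = (i == j)%:Z.
Proof. by rewrite sroot_sum rcoef_sum. Qed.

Lemma nonnegP x : nonneg x <-> inQ x /\ forall i, 0 <= rcoef x i.
Proof.
split=> [[c ->]|[Qx c0]]; first by split=> [|i]; [eexists | rewrite rcoef_sum].
exists (fun i => `|rcoef x i|%N); rewrite {1}(rcoefE Qx); apply: eq_bigr => i _.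
by rewrite gez0_abs.
Qed.

Lemma inQ_act s x : inQ x -> inQ (actX s x).
Proof.
elim: s => //= i s IHs /IHs H; rewrite /rX; apply: inQB => //; apply: inQZ.
exact: inQ_sroot.
Qed.

(** One word produces both the root and the coroot; that the root determines the coroot is proved in
    [rootp_inj]. *)
Definition rootp g h := exists s i, g = actX s (sroot i) /\ h = actY s (scoroot i).

Definition sX g h x : Xt D := x - pairing h x *: g.
Definition sY g h y : Yt D := y - pairing y g *: h.

Lemma rootp_sroot i : rootp (sroot i) (scoroot i).
Proof. by exists [::], i. Qed.

Lemma rootp_act s g h : rootp g h -> rootp (actX s g) (actY s h).
Proof. by case=> t [i [-> ->]]; exists (s ++ t), i; rewrite actX_cat actY_cat. Qed.

Lemma rootp_is_root g h : rootp g h -> is_root g.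
Proof. by case=> s [i [-> _]]; exists s, i. Qed.

Lemma rootp_pairing g h : rootp g h -> pairing h g = 2.
Proof. by case=> s [i [-> ->]]; rewrite pairing_act cartan_diag. Qed.

Lemma rootpN g h : rootp g h -> rootp (- g) (- h).
Proof.
case=> s [i [-> ->]]; exists (rcons s i), i; rewrite actX_rcons actY_rcons /rX /rY.
by rewrite cartan_diag !subr_scale2 actXN actYN.
Qed.

Lemma actX_refl v i x :
  actX (v ++ i :: rev v) x = sX (actX v (sroot i)) (actY v (scoroot i)) x.
Proof.
rewrite actX_cat /= {1}/rX actXB actXZ actX_Krev /sX; congr (_ - _ *: _).
by rewrite actY_adj.
Qed.

Lemma actY_refl v i y :
  actY (v ++ i :: rev v) y = sY (actX v (sroot i)) (actY v (scoroot i)) y.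
Proof.
rewrite actY_cat /= {1}/rY -scaleN1r actYD !actYZ actY_Krev /sY scaleN1r.
by congr (_ - _ *: _); rewrite actY_adj revK.
Qed.

Lemma rootp_word g h : rootp g h ->
  exists s, (forall x, actX s x = sX g h x) /\ (forall y, actY s y = sY g h y).
Proof.
case=> s [i [-> ->]]; exists (s ++ i :: rev s).
by split=> ?; rewrite ?actX_refl ?actY_refl.
Qed.

Lemma rootp_s g h g' h' : rootp g h -> rootp g' h' -> rootp (sX g h g') (sY g h h').
Proof. by move=> /rootp_word[s [sE sE']] /(rootp_act s); rewrite sE sE'. Qed.

Lemma rootp_inQ g h : rootp g h -> inQ g.
Proof. by case=> s [i [-> _]]; apply: inQ_act; apply: inQ_sroot. Qed.

Lemma rootp_or g h : rootp g h -> nonneg g \/ nonneg (- g).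
Proof. by case=> s [i [-> _]]; apply: root_nonneg_or. Qed.

Lemma rootp_neq0 g h : rootp g h -> g <> 0.
Proof. by move=> /rootp_pairing H g0; rewrite g0 pairing0r in H. Qed.

Lemma rootp_notN g h : rootp g h -> nonneg (- g) -> ~ nonneg g.
Proof. by move=> gh n p; apply: (rootp_neq0 gh); apply: nonneg_anti. Qed.

Lemma rootp_coef_gt0 g h i : rootp g h -> 0 < rcoef g i -> nonneg g.
Proof.
move=> gh ci; case: (rootp_or gh) => // /nonnegP[_ /(_ i)].
by rewrite rcoefN ?oppr_ge0 1?leNgt ?ci //; exact: rootp_inQ gh.
Qed.

Lemma rootp_coef_lt0 g h i : rootp g h -> rcoef g i < 0 -> nonneg (- g).
Proof.
move=> gh ci; apply: (@rootp_coef_gt0 _ (- h) i); first exact: rootpN.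
by rewrite rcoefN ?oppr_gt0 //; exact: rootp_inQ gh.
Qed.

(** The product of the two reflections is the transvection [x + f x *: sroot j] with
    [f = scoroot j - h]. For [l != j] it and its inverse send [sroot l] to roots with coordinate 1
    at [l], hence positive, so [f (sroot l)] and its opposite are both nonnegative. The transvection
    then fixes all simple roots, so it is trivial by [weq_nil]. *)
Lemma rootp_sroot_inj j h : rootp (sroot j) h -> h = scoroot j.
Proof.
move=> jh; have [w [wX _]] := rootp_word jh.
pose f x := pairing (scoroot j - h) x.
have fj : f (sroot j) = 0 by rewrite /f pairingBl cartan_diag (rootp_pairing jh).
have uX x : actX (rcons w j) x = x + f x *: sroot j.
  rewrite actX_rcons wX /sX /rX /f !pairing_lin (rootp_pairing jh) -addrA; congr (_ + _).
  by rewrite -opprD -scalerDl -scaleNr; congr (_ *: _); ring.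
have uinvX x : actX (rev (rcons w j)) x = x - f x *: sroot j.
  apply: (@actX_inj _ (rcons w j)); rewrite actX_Krev uX.
  have -> : f (x - f x *: sroot j) = f x.
    by rewrite {1}/f pairingBr pairingZr -/(f (sroot j)) fj mulr0 subr0.
  by rewrite subrK.
have f0 l : f (sroot l) = 0.
  have [->//|lj] := eqVneq l j.
  have cf t (a : int) : actX t (sroot l) = sroot l + a *: sroot j -> 0 <= a.
    have [Ql Qj] := (inQ_sroot l, inQ_sroot j).
    move=> e; have rt : rootp (actX t (sroot l)) (actY t (scoroot l)) by exists t, l.
    have /nonnegP[_ /(_ j)] : nonneg (actX t (sroot l)).
      apply: (rootp_coef_gt0 (i := l) rt); rewrite e rcoefD //; last exact: inQZ.
      by rewrite rcoefZ // !rcoef_sroot eqxx eq_sym (negbTE lj) mulr0.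
    rewrite e rcoefD //; last exact: inQZ.
    by rewrite rcoefZ // !rcoef_sroot eqxx (negbTE lj) mulr1 add0r.
  have := cf _ _ (uX _); have := cf (rev (rcons w j)) (- f (sroot l)).
  by rewrite scaleNr => /(_ (uinvX _)); lia.
have [uid _] : weq (rcons w j) [::].
  by apply: weq_nil => l; rewrite uX f0 scale0r addr0; apply: nonneg_sroot.
apply: pairing_injl => x; have := uid x; rewrite uX /=.
rewrite -[RHS]addr0 => /addrI e.
have := rcoefZ (f x) j (inQ_sroot j); rewrite e rcoef0 rcoef_sroot eqxx mulr1.
by rewrite /f pairingBl; lia.
Qed.

Lemma rootp_inj g h h' : rootp g h -> rootp g h' -> h = h'.
Proof.
case=> s [i [-> ->]] /(rootp_act (rev s)); rewrite actX_revK => /rootp_sroot_inj <-.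
by rewrite actY_Krev.
Qed.

(** Moving [g] back to a simple root [sroot l] writes the coordinate 1 at [l] as an integer multiple
    of [rcoef g i], which is therefore 1 or -1. *)
Lemma rootp_multiple_sroot g h i (k c : int) : rootp g h -> k != 0 ->
  k *: g = c *: sroot i -> g = sroot i \/ g = - sroot i.
Proof.
move=> gh k0 e; have Qg := rootp_inQ gh.
have gE : g = rcoef g i *: sroot i.
  rewrite {1}(rcoefE Qg) (bigD1 i) //= big1 ?addr0 // => j ji.
  have := rcoefZ k j Qg; rewrite e rcoefZ ?rcoef_sroot; last exact: inQ_sroot.
  rewrite eq_sym (negbTE ji) mulr0 => /esym/eqP; rewrite mulf_eq0 (negbTE k0) /=.
  by move=> /eqP->; rewrite scale0r.
have [s [l [gs _]]] := gh.
have : sroot l = rcoef g i *: actX (rev s) (sroot i).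
  by rewrite -actXZ -gE gs actX_revK.
have Qs := inQ_act (rev s) (inQ_sroot i).
move=> /(congr1 (rcoef^~ l)); rewrite rcoefZ // rcoef_sroot eqxx => /esym e1.
have [e2|e2] : rcoef g i = 1 \/ rcoef g i = -1.
  move: (rcoef g i) (rcoef _ l) e1 => a b ab.
  have : (`|a| * `|b| = 1)%N by rewrite -abszM ab.
  by move/eqP; rewrite muln_eq1 => /andP[/eqP ? _]; lia.
- by left; rewrite gE e2 scale1r.
- by right; rewrite gE e2 scaleN1r.
Qed.

Lemma rootp_coef_neq g h i : rootp g h -> nonneg g -> g <> sroot i ->
  exists2 j, j != i & 0 < rcoef g j.
Proof.
move=> gh /nonnegP[Qg gpos] gi; apply: NNPP => no.
have gE : 1 *: g = rcoef g i *: sroot i.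
  rewrite scale1r {1}(rcoefE Qg) (bigD1 i) //= big1 ?addr0 // => j ji.
  have [->|cj] := eqVneq (rcoef g j) 0; first by rewrite scale0r.
  by case: no; exists j => //; rewrite lt_def cj gpos.
have [//|gN] := rootp_multiple_sroot gh (oner_neq0 _) gE.
have := gpos i; rewrite gN rcoefN ?rcoef_sroot ?eqxx //; exact: inQ_sroot.
Qed.

(** The reflection changes only the coordinate at [i], and [g] has a positive coordinate elsewhere;
    one positive coordinate makes a root positive. *)
Lemma rX_nonneg g h i : rootp g h -> nonneg g -> g <> sroot i -> nonneg (rX i g).
Proof.
move=> gh gpos gi; have Qg := rootp_inQ gh.
have [j ji cj] := rootp_coef_neq gh gpos gi.
have rg : rootp (rX i g) (rY i h) by apply: (@rootp_act [:: i]).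
apply: (rootp_coef_gt0 (i := j) rg).
rewrite /rX rcoefB ?rcoefZ ?rcoef_sroot //; try exact: inQ_sroot; last by apply: inQZ; exact: inQ_sroot.
by rewrite eq_sym (negbTE ji) mulr0 subr0.
Qed.

(** A new first letter [i] can add only the inversion [s^-1(alpha_i)]. *)
Lemma inversions_finite s : exists L : seq (Xt D), forall g h,
  rootp g h -> nonneg g -> ~ nonneg (actX s g) -> g \in L.
Proof.
elim: s => [|i s [L LP]]; first by exists [::] => g h.
exists (actX (rev s) (sroot i) :: L) => g h gh gpos /= gneg.
rewrite inE; have [e|ne] := eqVneq (actX s g) (sroot i).
  by rewrite -e actX_revK eqxx.
rewrite (LP g h) ?orbT // => spos; apply: gneg.
by apply: (rX_nonneg (rootp_act s gh)) => //; apply/eqP.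
Qed.

End RootPairs.

Lemma size_filter_neq (T : eqType) (a : T) (s : seq T) :
  a \in s -> (size [seq x <- s | x != a] < size s)%N.
Proof.
rewrite size_filter (@eq_count _ _ (predC (pred1 a))) // => aS.
rewrite -(count_predC (pred1 a) s) -addn1 addnC leq_add2r.
by rewrite -has_count has_pred1.
Qed.

(** * The Tits cone *)

Section TitsCone.
Variable D : KMRootDatum.
Implicit Types (s t v w z : word D) (i j : idx D) (g : Xt D) (h lam : Yt D).

Lemma inYplus_act s lam : inYplus lam -> inYplus (actY s lam).
Proof. by case=> t [nu [nu_dom ->]]; exists (s ++ t), nu; rewrite actY_cat. Qed.

(** For the converse, reflect in a simple root that is negative on [lam]: this permutes the other
    positive roots and so shortens the list [L]. *)
Lemma inYplusP lam : inYplus lam <->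
  exists L : seq (Xt D), forall g h, rootp g h -> nonneg g -> pairing lam g < 0 -> g \in L.
Proof.
split=> [[s [nu [nu_dom ->]]]|[L]].
  have [L LP] := inversions_finite (rev s); exists L => g h gh gpos.
  rewrite actY_adj => lt0; apply: (LP g h) => // -[c e]; move: lt0; rewrite e.
  rewrite pairing_sumr ltNge sumr_ge0 // => i _.
  by rewrite pairingZr mulr_ge0.
have [n] := ubnP (size L); elim: n => // n IHn in L lam * => lt_n LP.
have [dom|/not_all_ex_not[i /negP]] := classic (dominant lam).
  by exists [::], lam.
rewrite -ltNge => lt0.
suff /(inYplus_act [:: i]) : inYplus (rY i lam).
  by rewrite -[actY _ _]/(actY [:: i] (actY [:: i] lam)) (actY_Krev [:: i]).
apply: (IHn [seq rX i g | g <- L & g != sroot i]).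
  have iL : sroot i \in L by apply: (LP _ _ (rootp_sroot i)) => //; exact: nonneg_sroot.
  by rewrite size_map; apply: leq_trans (size_filter_neq iL) _.
move=> g h gh gpos; rewrite rX_adj => ltg.
have gi : g <> sroot i.
  by move=> e; move: ltg; rewrite e /rX cartan_diag subr_scale2 pairingNr; lia.
have rpos := rX_nonneg gh gpos gi.
apply/mapP; exists (rX i g); last by rewrite rXK.
have rg : rootp (rX i g) (rY i h) by apply: (@rootp_act _ [:: i]).
rewrite mem_filter (LP _ _ rg) // andbT; apply/eqP => e.
have : g = - sroot i by rewrite -[g](rXK i) e /rX cartan_diag subr_scale2.
move=> e'; apply: (rootp_notN gh) => //; rewrite e' opprK; exact: nonneg_sroot.
Qed.

(** The point lies between [lam] and its reflection, so a root negative on it is negative on one of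
    these two endpoints. *)
Lemma inYplus_segment lam g h k : rootp g h -> inYplus lam ->
  0 <= k <= pairing lam g -> inYplus (lam - k *: h).
Proof.
move=> gh lamY /andP[k0 kN]; have [s [_ sY_]] := rootp_word gh.
have /inYplusP[L2 P2] : inYplus (sY g h lam) by rewrite -sY_; apply: inYplus_act.
have /inYplusP[L1 P1] := lamY; apply/inYplusP; exists (L1 ++ L2) => a b ab apos lt0.
rewrite mem_cat; have [lt1|ge1] := ltP (pairing lam a) 0; first by rewrite (P1 a b).
have [lt2|ge2] := ltP (pairing (sY g h lam) a) 0; first by rewrite (P2 a b) ?orbT.
exfalso; move: lt0 ge1 ge2; rewrite /sY !pairing_lin.
move: (pairing lam a) (pairing h a) (pairing lam g) kN => P q N kN.
by have [q0|q0] := lerP q 0; nia.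
Qed.

End TitsCone.

(** * Affine reflections and positivity of affine roots *)

Section AffineReflections.
Variable D : KMRootDatum.
Implicit Types (g d e : Xt D) (h k lam : Yt D) (m n : int) (x y z : aff D).

Lemma sX_lin g h a u u' : sX g h (a *: u + u' : Xt D) = a *: sX g h u + sX g h u'.
Proof. by rewrite /sX !pairing_lin scalerDl scalerBr scalerA addrACA opprD. Qed.

Lemma sY_lin g h a u u' : sY g h (a *: u + u' : Yt D) = a *: sY g h u + sY g h u'.
Proof. by rewrite /sY !pairing_lin scalerDl scalerBr scalerA addrACA opprD. Qed.

Lemma sXK g h : rootp g h -> involutive (sX g h).
Proof.
move=> gh u; rewrite /sX !pairing_lin (rootp_pairing gh) -addrA -opprD -scalerDl.
set p := pairing _ _.
have -> : p + (p + - (p * 2)) = 0 by ring.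
by rewrite scale0r subr0.
Qed.

Lemma sYK g h : rootp g h -> involutive (sY g h).
Proof.
move=> gh u; rewrite /sY !pairing_lin (rootp_pairing gh) -addrA -opprD -scalerDl.
set p := pairing _ _; have -> : p + (p + - (p * 2)) = 0 by ring.
by rewrite scale0r subr0.
Qed.

Lemma sX_self g h : rootp g h -> sX g h g = - g.
Proof. by move=> gh; rewrite /sX (rootp_pairing gh) subr_scale2. Qed.

Lemma sXN g h u : sX (- g) (- h) u = sX g h u.
Proof. by rewrite /sX pairingNl scalerN scaleNr opprK. Qed.

Lemma sYN g h u : sY (- g) (- h) u = sY g h u.
Proof. by rewrite /sY pairingNr scalerN scaleNr opprK. Qed.

Lemma sX_opp g h u : sX g h (- u) = - sX g h u.
Proof. by rewrite /sX pairingNr scaleNr -opprD. Qed.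

Lemma pairing_sYX g h u v : rootp g h -> pairing (sY g h u) (sX g h v) = pairing u v.
Proof.
move=> gh; rewrite /sX /sY !pairing_lin (rootp_pairing gh); ring.
Qed.

Lemma sX_conj g h d k u : rootp d k ->
  sX (sX d k g) (sY d k h) (sX d k u) = sX d k (sX g h u).
Proof.
move=> dk; rewrite {1}/sX pairing_sYX // -scaleNr addrC -sX_lin scaleNr addrC.
by [].
Qed.

Lemma sY_conj g h d k u : rootp d k ->
  sY (sX d k g) (sY d k h) (sY d k u) = sY d k (sY g h u).
Proof.
move=> dk; rewrite {1}/sY pairing_sYX // -scaleNr addrC -sY_lin scaleNr addrC.
by [].
Qed.

(* [z] is the product of the reflection in the affine root [(g, m)] with [y]. *)
Definition isrefl g h m z y :=
  z.1 = m *: h + sY g h y.1 /\ forall u, actX z.2 u = sX g h (actX y.2 u).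

Lemma isrefl_ex g h m y : rootp g h -> exists z, isrefl g h m z y.
Proof.
move=> /rootp_word[s [sXE sYE]]; exists (m *: h + actY s y.1, s ++ y.2).
by split=> [|u] /=; rewrite ?sYE ?actX_cat ?sXE.
Qed.

Lemma isreflN g h m z y : isrefl g h m z y -> isrefl (- g) (- h) (- m) z y.
Proof. by case=> e1 e2; split=> [|u]; rewrite ?sYN ?sXN // e1 scalerN scaleNr opprK. Qed.

Lemma isrefl_sym g h m z y : rootp g h -> isrefl g h m z y -> isrefl g h m y z.
Proof.
move=> gh [e1 e2]; split=> [|u]; last by rewrite e2 sXK.
rewrite e1 sY_lin sYK // {1}/sY (rootp_pairing gh) subr_scale2 scalerN.
by rewrite addrA subrr add0r.
Qed.

(** Conjugating the reflection in [(g, m)] by the one in [(d, n)] gives the reflection in the image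
    of [(g, m)]. *)
Lemma isrefl_conj g h m d k n x y z z' : rootp d k ->
  isrefl g h m x y -> isrefl d k n z y -> isrefl d k n z' x ->
  isrefl (sX d k g) (sY d k h) (m - pairing k g * n) z' z.
Proof.
move=> dk [x1 x2] [z1 z2] [z'1 z'2]; split=> [|u]; last first.
  by rewrite z'2 x2 z2 sX_conj.
have e : sY (sX d k g) (sY d k h) k = k + pairing k g *: sY d k h.
  rewrite {1}/sY pairingBr pairingZr (rootp_pairing dk) -scaleNr.
  by congr (_ + _ *: _); ring.
rewrite z'1 x1 z1 !sY_lin sY_conj // e.
move: (sY d k h) (sY d k (sY g h y.1)) (pairing k g) => h' S p.
rewrite scalerDr scalerA scalerBl !addrA; congr (_ + S).
by rewrite [p * n]mulrC addrAC subrK addrC.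
Qed.

(** Positivity stated for any vector [u], so that it is stable under sums and nonnegative
    multiples. *)
Definition ap (u : Xt D) m := 0 < m \/ m = 0 /\ nonneg u.

Lemma apD u m u' m' : ap u m -> ap u' m' -> ap (u + u') (m + m').
Proof.
case=> [?|[-> n1]] [?|[-> n2]]; [left|left|left|right]; try lia.
by rewrite addr0; split=> //; apply: nonnegD.
Qed.

Lemma apZ a u m : 0 <= a -> ap u m -> ap (a *: u) (a * m).
Proof.
rewrite le0r => /orP[/eqP-> _|a0 [m0|[-> n1]]].
- by right; rewrite mul0r scale0r; split=> //; exists (fun=> 0%N); rewrite big1 // => i _; rewrite scale0r.
- by left; rewrite mulr_gt0.
- by right; rewrite mulr0; split=> //; apply: nonnegZ => //; apply: ltW.
Qed.

Lemma ap_or g h m : rootp g h -> ap g m \/ ap (- g) (- m).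
Proof.
move=> gh; rewrite /ap oppr_gt0.
have [?|?|->] := ltgtP m 0; [by right; left | by left; left |].
by case: (rootp_or gh) => ?; [left|right]; right; rewrite ?oppr0.
Qed.

Lemma apN g h m : rootp g h -> ap g m -> ~ ap (- g) (- m).
Proof.
move=> gh [m0|[-> n1]] [m0'|[e n2]]; try by [lia | move: e; lia].
by apply: (rootp_neq0 gh); apply: nonneg_anti.
Qed.

Lemma pos_aff_rootP g h m : rootp g h -> pos_aff_root (g, m) <-> ap g m.
Proof.
move=> gh; have gr := rootp_is_root gh; rewrite /pos_aff_root /ap /is_pos_root /=.
split=> [[_ [?|[? [_ ?]]]]|[?|[? ?]]]; [by left | by right | |] => //.
  by split=> //; left.
by split=> //; right.
Qed.

(* The affine root [y^-1 (g, m)] is positive. *)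
Definition iap y g m := ap (actX (rev y.2) g) (m - pairing y.1 g).

Lemma rootp_iact y g h : rootp g h -> rootp (actX (rev y.2) g) (actY (rev y.2) h).
Proof. exact: rootp_act. Qed.

(** From [z = s_a y] follows [z^-1 = y^-1 s_a]. *)
Lemma iap_isrefl g h m z y u n : rootp g h -> isrefl g h m z y ->
  iap z u n = iap y (sX g h u) (n - pairing h u * m).
Proof.
move=> gh [e1 e2]; rewrite /iap; congr (ap _ _).
  apply: (@actX_inj _ z.2); rewrite actX_Krev e2 actX_Krev sXK //.
rewrite e1 /sX /sY !pairing_lin; ring.
Qed.

Lemma iapN y g h m : rootp g h -> iap y g m -> ~ iap y (- g) (- m).
Proof.
move=> /(rootp_iact y)/apN H /H.
by rewrite /iap actXN pairingNr -opprD.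
Qed.

Lemma bstep_isrefl g h m z y : rootp g h -> isrefl g h m z y -> inWplus y ->
  ap g m -> ~ iap y g m -> inWplus z /\ bstep z y.
Proof.
move=> gh [e1 e2] yW ag iag.
have zW : inWplus z.
  (* The translation part of [z] is [y.1 - (N - m) *: h] with [N = pairing y.1 g] and [0 <= m <= N]:
     a point of the segment from [y.1] to its reflection. *)
  rewrite /inWplus e1 /sY addrCA -scalerBl -opprB scaleNr.
  apply: (inYplus_segment gh) => //.
  have m0 : 0 <= m by case: ag => [/ltW|[-> _]].
  rewrite lerBlDr lerDl m0 subr_ge0 andbT leNgt; apply/negP => lt.
  by apply: iag; left; rewrite subr_gt0.
split=> //; split=> //; split=> //; have [v [i [ge he]]] := gh.
exists v, i, m; rewrite -ge; split; first by apply/(pos_aff_rootP _ gh).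
split.
  rewrite /aff_act /aff_inv /= pairingNl pairing_act.
  by rewrite (pos_aff_rootP _ (rootp_iact y gh)).
split; first by rewrite e1 /= -he actY_refl -ge -he.
by apply: weqX => u; rewrite e2 /= actX_cat actX_refl -ge -he.
Qed.

End AffineReflections.

Ltac rowring := apply/rowP => ?; rewrite !mxE; ring.

Lemma scalerz_eq0 N a (u : 'rV[int]_N) : a <> 0 -> a *: u = 0 -> u = 0.
Proof.
move=> /eqP a0 /rowP au0; apply/rowP => j; have := au0 j.
by rewrite !mxE => /eqP; rewrite mulf_eq0 (negbTE a0) => /eqP.
Qed.

(** * Elements strictly between [s_a y] and [y], from dihedral chains *)

Section Chains.
Variable D : KMRootDatum.
Implicit Types (g d e : Xt D) (h k lam : Yt D) (m n : int) (x y z : aff D).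

Lemma isrefl_not_aeq g h m z y : rootp g h -> isrefl g h m z y -> ~ aeq z y.
Proof.
move=> gh [_ zX] [_ [zy _]].
have := zX (actX (rev y.2) g); rewrite zy actX_Krev sX_self // => e.
have := rootp_pairing gh; have := rootp_pairing (rootpN gh).
by rewrite -e pairingNl; lia.
Qed.

(** If the two reflections agree, both send [d] to [- d]. *)
Lemma isrefl_aeq g h m d k n z z' y : rootp g h -> rootp d k ->
  isrefl g h m z y -> isrefl d k n z' y -> aeq z z' -> d + d = pairing h d *: g.
Proof.
move=> gh dk [_ zX] [_ z'X] [_ [zz' _]].
have := zX (actX (rev y.2) d); rewrite zz' z'X actX_Krev sX_self // /sX => e.
by rewrite -[pairing h d *: g](subKr d) -e opprK.
Qed.

Lemma ble_bstep x y : bstep x y -> ble x y.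
Proof. by move=> xy; apply: rt_step; right. Qed.

Definition has_between x y := exists z, blt x z /\ blt z y.

Lemma has_between3 x z' z y : bstep z y -> ~ aeq z y -> bstep z' z -> bstep x z' ->
  ~ aeq x z -> has_between x y.
Proof.
move=> zy nzy z'z xz' nxz; exists z; split; split=> //; last exact: ble_bstep.
exact: rt_trans (ble_bstep xz') (ble_bstep z'z).
Qed.

Section Dihedral.
Variables (x y : aff D) (g : Xt D) (h : Yt D) (m : int).
Hypotheses (gh : rootp g h) (yW : inWplus y) (xy : isrefl g h m x y).
Hypotheses (ag : ap g m) (iag : ~ iap y g m).

(* [d] and [d'' = - s_a d] are positive affine roots made negative by [y^-1]. *)
Definition good d k n := [/\ rootp d k, ap d n /\ ~ iap y d n,
  ap (pairing h d *: g - d) (pairing h d * m - n),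
  ~ iap y (pairing h d *: g - d) (pairing h d * m - n) &
  d + d <> pairing h d *: g].

(** Otherwise [- d] would be the sum of [d''] and a nonnegative multiple of [a], hence positive
    together with [d]. *)
Lemma good_pairing_gt0 d k n : good d k n -> 0 < pairing h d.
Proof.
case=> dk [apd _] apd'' _ _; rewrite ltNge; apply/negP => le0.
apply: (apN dk apd).
have le0' : 0 <= - pairing h d by rewrite oppr_ge0.
have := apD apd'' (apZ le0' ag).
by rewrite scaleNr mulNr addrAC subrr add0r addrAC subrr add0r.
Qed.

(** The map from [d] to [d''] is an involution exchanging the conditions on the two. *)
Lemma good_opp d k n : good d k n ->
  good (pairing h d *: g - d) (pairing k g *: h - k) (pairing h d * m - n).
Proof.
case=> dk [apd iapd] apd'' iapd'' ne.
have e : pairing h (pairing h d *: g - d) = pairing h d.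
  by rewrite pairingBr pairingZr (rootp_pairing gh); ring.
split; rewrite ?e.
- have := rootpN (rootp_s gh dk); rewrite /sX /sY !opprB //.
- by [].
- by rewrite !subKr.
- by rewrite !subKr.
- move=> e2; apply: ne.
  have : pairing h d *: g - d + (pairing h d *: g - d) + (d + d) = pairing h d *: g + (d + d).
    by rewrite e2.
  by rewrite addrACA subrK => /addrI.
Qed.

(* [e = - s_d a]: if [e] is negative then [y > s_d y > s_d s_a y > s_a y], and if
   [y^-1 e] is positive then [y > s_d y > s_a s_d y > s_a y]. *)
Lemma good_between d k n : good d k n ->
  ~ ap (pairing k g *: d - g) (pairing k g * n - m) \/
  iap y (pairing k g *: d - g) (pairing k g * n - m) -> has_between x y.
Proof.
case=> dk [apd iapd] apd'' iapd'' ne cond.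
have [z1 z1P] := isrefl_ex n y dk.
have [z1W z1y] := bstep_isrefl dk z1P yW apd iapd.
have nz1 := isrefl_not_aeq dk z1P.
have nxz1 : ~ aeq x z1 by move=> xz1; exact: ne (isrefl_aeq gh dk xy z1P xz1).
have sdg : rootp (sX d k g) (sY d k h) := rootp_s dk gh.
have sgd : rootp (sX g h d) (sY g h k) := rootp_s gh dk.
have eE : sX d k g = - (pairing k g *: d - g) by rewrite opprB.
have enE : m - pairing k g * n = - (pairing k g * n - m) by rewrite opprB.
have dE : sX g h d = - (pairing h d *: g - d) by rewrite opprB.
have dnE : n - pairing h d * m = - (pairing h d * m - n) by rewrite opprB.
case: cond => [nape|iape].
- have [z2 z2P] := isrefl_ex n x dk.
  (* Here [z2 = s_d s_a y] is the reflection of [z1 = s_d y] in [s_d a = - e]. *)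
  have z21 := isrefl_conj dk xy z1P z2P.
  have [z2W z2z1] : inWplus z2 /\ bstep z2 z1.
    apply: (bstep_isrefl sdg z21 z1W).
      rewrite eE enE; case: (ap_or (m - pairing k g * n) sdg) => //.
        by rewrite eE enE.
      by rewrite eE enE !opprK => /nape.
    rewrite (iap_isrefl _ _ dk z1P) sXK //.
    suff -> : m - pairing k g * n - pairing k (sX d k g) * n = m by [].
    by rewrite /sX pairingBr pairingZr (rootp_pairing dk); ring.
  have xz2 := isrefl_sym dk z2P.
  have [_ xz2'] : inWplus x /\ bstep x z2.
    apply: (bstep_isrefl dk xz2 z2W apd).
    rewrite (iap_isrefl _ _ dk z2P) (iap_isrefl _ _ gh xy) sX_self // sX_opp dE opprK.
    suff -> : n - pairing k d * n - pairing h (- d) * m = pairing h d * m - n by [].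
    by rewrite pairingNr (rootp_pairing dk); ring.
  exact: has_between3 z1y nz1 z2z1 xz2' nxz1.
- have [z2 z2P] := isrefl_ex m z1 gh.
  have [z2W z2z1] : inWplus z2 /\ bstep z2 z1.
    apply: (bstep_isrefl gh z2P z1W ag).
    rewrite (iap_isrefl _ _ dk z1P) eE enE; apply: iapN iape.
    by have := rootpN sdg; rewrite eE opprK; apply.
  (* Here [z2 = s_a s_d y] is the reflection of [x = s_a y] in [s_a d], which is [- d'']. *)
  have z2x := isreflN (isrefl_conj gh z1P xy z2P).
  have xz2 := isrefl_sym (rootpN sgd) z2x.
  have [_ xz2'] : inWplus x /\ bstep x z2.
    apply: (bstep_isrefl (rootpN sgd) xz2 z2W).
      by rewrite dE dnE !opprK.
    rewrite (iap_isrefl _ _ gh z2P) (iap_isrefl _ _ dk z1P) sX_opp sXK // sX_opp sX_self // opprK.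
    suff -> : - (n - pairing h d * m) - pairing h (- sX g h d) * m -
       pairing k (- d) * n = n by [].
    rewrite /sX !pairing_lin (rootp_pairing gh) (rootp_pairing dk); ring.
  exact: has_between3 z1y nz1 z2z1 xz2' nxz1.
Qed.

(** The l^1 norm in the ambient coordinates, not the height with respect to simple roots. *)
Definition height1 (u : Xt D) : nat := (\sum_j `|u ord0 j|)%N.

Lemma height1Z a u : height1 (a *: u) = (`|a| * height1 u)%N.
Proof. by rewrite /height1 big_distrr; apply: eq_bigr => j _; rewrite mxE abszM. Qed.

Lemma height1_gt0 u : u <> 0 -> (0 < height1 u)%N.
Proof.
move=> u0; rewrite lt0n; apply/negP; rewrite /height1 sum_nat_eq0 => /forallP H.
apply: u0; apply/rowP => j; have := H j.
by rewrite mxE absz_eq0 => /eqP.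
Qed.

(** If [good_between] yields nothing for [d] nor for [d''], then [e = - s_d a] and [- s_d'' a] are
    both positive and inverted by [y^-1]; these are exchanged by [- s_a], so [e] is good. If
    [pairing k g] were 0, [e] would be [- a]. *)
Lemma good_descend d k n : good d k n -> has_between x y \/
  [/\ good (pairing k g *: d - g) (pairing h d *: k - h) (pairing k g * n - m),
      pairing h (pairing k g *: d - g) = pairing k g * pairing h d - 2,
      pairing (pairing h d *: k - h) g = pairing k g * pairing h d - 2 & pairing k g <> 0].
Proof.
move=> dgood; have [|nb] := classic (has_between x y); [by left | right].
have /not_or_and[/NNPP ape niape] := contra_not (good_between dgood) nb.
have := contra_not (good_between (good_opp dgood)) nb.
have [dk [apd iapd] apd'' iapd'' ne] := dgood.
have -> : pairing (pairing k g *: h - k) g = pairing k g.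
  by rewrite pairingBl pairingZl (rootp_pairing gh); ring.
move=> /not_or_and[/NNPP ape'' niape''].
have c'0 : pairing k g <> 0.
  move=> c'0; move: ape; rewrite c'0 scale0r mul0r !sub0r; exact: apN gh ag.
have ce : pairing h (pairing k g *: d - g) = pairing k g * pairing h d - 2.
  by rewrite pairingBr pairingZr (rootp_pairing gh).
have eg : (pairing k g * pairing h d - 2) *: g - (pairing k g *: d - g) =
    pairing k g *: (pairing h d *: g - d) - g.
  by rowring.
have en : (pairing k g * pairing h d - 2) * m - (pairing k g * n - m) =
    pairing k g * (pairing h d * m - n) - m by ring.
split=> //.
  split; rewrite ?ce ?eg ?en //.
    by have := rootpN (rootp_s dk gh); rewrite /sX /sY !opprB.
  move=> e; apply: ne; apply/eqP; rewrite -subr_eq0; apply/eqP.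
  have : pairing k g *: (d + d - pairing h d *: g) = 0.
    by move/eqP: e; rewrite -subr_eq0 => /eqP <-; rowring.
  exact: scalerz_eq0.
by rewrite pairingBl pairingZl (rootp_pairing gh) mulrC.
Qed.

(** Induction on the gap [f] below the maximal norm on [L]. With equal pairings [c], goodness of the
    next root gives [c * c - 2 > 0], so [c >= 2] and the norm at least doubles. *)
Lemma good_has_between_bounded f d k n (L : seq (Xt D)) :
  (forall d k n, good d k n -> d \in L) -> good d k n -> pairing h d = pairing k g ->
  (\max_(e <- L) height1 (e + e - pairing h e *: g)%R <
     height1 (d + d - pairing h d *: g)%R + f)%N -> has_between x y.
Proof.
move=> LP; elim: f d k n => [|f IHf] d k n dgood cc' lt_f.
  rewrite addn0 in lt_f; suff : false by [].
  have := @leq_bigmax_seq _ L xpredT (fun e => height1 (e + e - pairing h e *: g)%R) _ (LP _ _ _ dgood) isT.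
  by move=> /(leq_trans lt_f); rewrite ltnn.
have [//|[egood ce ce' c'0]] := good_descend dgood.
have c_gt0 := good_pairing_gt0 dgood; have ce_gt0 := good_pairing_gt0 egood.
apply: (IHf _ _ _ egood); first by rewrite ce ce'.
have -> : pairing k g *: d - g + (pairing k g *: d - g) -
    pairing h (pairing k g *: d - g) *: g = pairing k g *: (d + d - pairing h d *: g).
  by rewrite ce; rowring.
have : (0 < height1 (d + d - pairing h d *: g)%R)%N.
  apply: height1_gt0 => /eqP; rewrite subr_eq0 => /eqP.
  by case: dgood.
have c2 : (2 <= `|pairing k g|)%N.
  by move: c_gt0 ce_gt0; rewrite ce cc'; case: (pairing k g) => // -[|[|?]].
rewrite height1Z; move: lt_f c2; nia.
Qed.

(* Iterating [good_descend] multiplies [2 d - <a^vee, d> a] by [<d^vee, a> >= 2],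
   which cannot go on inside the finite list [L]. *)
Lemma good_has_between d k n (L : seq (Xt D)) :
  (forall d k n, good d k n -> d \in L) -> good d k n -> has_between x y.
Proof.
(* A first descent makes the two pairings equal: both become [pairing k g * pairing h d - 2]. *)
move=> LP dgood; have [//|[egood ce ce' _]] := good_descend dgood.
apply: (good_has_between_bounded LP egood); first by rewrite ce ce'.
exact: (@ltn_addl _ _ _ (ltnSn _)).
Qed.

End Dihedral.
End Chains.

Lemma infinite_pigeonhole (T : finType) (f : nat -> T) :
  exists v, forall n, exists2 t, (n <= t)%N & f t = v.
Proof.
apply: NNPP => no.
have /fin_all_exists[N NP] : forall v, exists n, forall t, (n <= t)%N -> f t <> v.
  move=> v; apply: NNPP => nv; apply: no; exists v => n; apply: NNPP => nt.
  by apply: nv; exists n => t nt' ft; apply: nt; exists t.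
apply: (NP (f (\max_v N v)%N) (\max_v N v)%N) => //.
exact: leq_bigmax.
Qed.

(** * Inversions of the reflection in a root, along ascents *)

Section Depth.
Variable D : KMRootDatum.
Implicit Types (i j : idx D) (e : Xt D) (b c : Xt D * Yt D).

Definition posp b := rootp b.1 b.2 /\ nonneg b.1.
Definition child i b : Xt D * Yt D := (rX i b.1, rY i b.2).
(** In this case [rX i] adds a positive multiple of [sroot i] to the root. *)
Definition asc i b := pairing b.2 (sroot i) < 0.

Definition refl_inv b e := (exists k, rootp e k) /\ nonneg e /\ nonneg (- sX b.1 b.2 e).

Lemma rootp_r i e k : rootp e k -> rootp (rX i e) (rY i k).
Proof. exact: (@rootp_act _ [:: i]). Qed.

Lemma rX_sroot i : rX i (sroot i) = - sroot i.
Proof. by rewrite /rX cartan_diag subr_scale2. Qed.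

Lemma rX_opp i e : rX i (- e) = - rX i e.
Proof. exact: (@actXN _ [:: i]). Qed.

Lemma nonneg_neq_opp i e : nonneg e -> rX i e <> sroot i.
Proof.
move=> e0 ei; apply: (rootp_notN (rootpN (rootp_sroot i))).
  by rewrite opprK; apply: nonneg_sroot.
by rewrite -rX_sroot -ei rXK.
Qed.

Lemma rYK i : involutive (@rY D i).
Proof. exact: (@actY_Krev _ [:: i]). Qed.

Lemma childK i b : child i (child i b) = b.
Proof. by rewrite /child rXK rYK -surjective_pairing. Qed.

Lemma pairing_child i b e : pairing (child i b).2 (rX i e) = pairing b.2 e.
Proof. by rewrite rX_adj rXK. Qed.

Lemma pairing_child_sroot i b : pairing (child i b).2 (sroot i) = - pairing b.2 (sroot i).
Proof. by rewrite rX_adj rX_sroot pairingNr. Qed.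

Lemma sX_child i b e :
  sX (child i b).1 (child i b).2 (rX i e) = rX i (sX b.1 b.2 e).
Proof. exact: (sX_conj _ _ _ (rootp_sroot i)). Qed.

Lemma asc_neq i b : posp b -> asc i b -> b.1 <> sroot i.
Proof. by move=> [bp _] + e; rewrite /asc -e (rootp_pairing bp). Qed.

Lemma posp_child i b : posp b -> asc i b -> posp (child i b).
Proof.
move=> bp bi; have [b1 b2] := bp; split; first exact: rootp_r.
exact: rX_nonneg b1 b2 (asc_neq bp bi).
Qed.

Lemma refl_inv_neq i b e : posp b -> asc i b -> refl_inv b e -> e <> sroot i.
Proof.
move=> [b1 b2] bi [_ [_ e3]] ei; have sr := rootp_s b1 (rootp_sroot i).
rewrite ei in e3; apply: (rootp_notN sr e3).
rewrite /sX -scaleNr; apply: nonnegD; first exact: nonneg_sroot.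
by apply: nonnegZ => //; rewrite oppr_ge0 ltW.
Qed.

(** Conjugation by [r_i] turns [s_b] into the reflection of the child. Positivity could be lost only
    at [alpha_i], but neither [e] nor [- s_b e] is [alpha_i], since the ascent makes [s_b(alpha_i)]
    positive. *)
Lemma refl_inv_child i b e : posp b -> asc i b -> refl_inv b e -> refl_inv (child i b) (rX i e).
Proof.
move=> bp bi ie; have [b1 b2] := bp; have [[k ek] [e2 e3]] := ie.
split; first by exists (rY i k); apply: rootp_r.
split; first by apply: (rX_nonneg ek) => //; apply: refl_inv_neq ie.
rewrite sX_child -rX_opp; apply: (rX_nonneg (rootpN (rootp_s b1 ek))) => //.
move=> eq; have eE : e = - sX b.1 b.2 (sroot i).
  by rewrite -eq sX_opp sXK // opprK.
apply: (rootp_notN ek) => //; rewrite eE opprK /sX -scaleNr.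
apply: nonnegD; first exact: nonneg_sroot.
by apply: nonnegZ => //; rewrite oppr_ge0 ltW.
Qed.

(** The child's reflection sends [alpha_i] to [- r_i s_b(alpha_i)], and [s_b(alpha_i)] is a positive
    root other than [alpha_i]. *)
Lemma refl_inv_new i b : posp b -> asc i b -> refl_inv (child i b) (sroot i).
Proof.
move=> [b1 b2] bi; split; first by exists (scoroot i); apply: rootp_sroot.
split; first exact: nonneg_sroot.
have sr := rootp_s b1 (rootp_sroot i).
have {1}<- : rX i (- sroot i) = sroot i by rewrite rX_opp rX_sroot opprK.
rewrite sX_child sX_opp rX_opp opprK.
apply: (rX_nonneg sr); rewrite /sX -scaleNr.
  apply: nonnegD; first exact: nonneg_sroot.
  by apply: nonnegZ => //; rewrite oppr_ge0 ltW.
rewrite -[RHS]addr0 => /addrI/scalerz_eq0 b0; apply: (rootp_neq0 b1); apply: b0.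
by move: bi; rewrite /asc; lia.
Qed.

Lemma refl_inv_finite b : rootp b.1 b.2 -> exists L : seq (Xt D), forall e, refl_inv b e -> e \in L.
Proof.
move=> b1; have [w [wX _]] := rootp_word b1; have [L LP] := inversions_finite w.
exists L => e [[k ek] [e2 e3]]; apply: (LP e k) => //; rewrite wX.
exact: rootp_notN (rootp_s b1 ek) e3.
Qed.

(** As the pairing of [b.2] with [b.1] is 2, some [alpha_i] pairs positively with [b.2]. Unless [b]
    is simple, reflecting in it undoes an ascent, and the list of inversions shortens because
    [alpha_i] is lost. *)
Lemma posp_induction (P : Xt D * Yt D -> Prop) :
  (forall i, P (sroot i, scoroot i)) ->
  (forall i b, posp b -> asc i b -> P b -> P (child i b)) ->
  forall b, posp b -> P b.
Proof.
move=> P0 PS b bp; have [L LP] := refl_inv_finite (proj1 bp).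
have [n] := ubnP (size L); elim: n => // n IHn in L b bp LP * => lt_n.
have [b1 b2] := bp; have /nonnegP[Qb bpos] := b2.
have [i bi] : exists i, 0 < pairing b.2 (sroot i).
  apply: NNPP => no; have := rootp_pairing b1; rewrite (rcoefE Qb) pairing_sumr => e.
  have : \sum_i pairing b.2 (rcoef b.1 i *: sroot i) <= 0.
    apply: sumr_le0 => i _; rewrite pairingZr; apply: mulr_ge0_le0 => //.
    by rewrite leNgt; apply/negP => bi; apply: no; exists i.
  by rewrite e.
have [e|/eqP bi'] := eqVneq b.1 (sroot i).
  have -> : b = (sroot i, scoroot i); last exact: P0.
  rewrite [b]surjective_pairing e; congr (_, _).
  by apply: rootp_sroot_inj; rewrite -e.
have cp : posp (child i b) by split; [apply: rootp_r | apply: rX_nonneg b1 b2 bi'].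
have ca : asc i (child i b) by rewrite /asc pairing_child_sroot oppr_lt0.
rewrite -(childK i b); apply: PS => //.
apply: (IHn [seq rX i e | e <- L & e != sroot i]) => //.
  move=> e /[dup] ie /(refl_inv_child cp ca); rewrite childK => /LP reL.
  apply/mapP; exists (rX i e); last by rewrite rXK.
  rewrite mem_filter reL andbT; apply/eqP; apply: nonneg_neq_opp.
  by case: ie => _ [].
have iL : sroot i \in L.
  apply: LP; split; first by exists (scoroot i); apply: rootp_sroot.
  split; first exact: nonneg_sroot.
  have [j ji cj] := rootp_coef_neq b1 b2 bi'.
  apply: (rootp_coef_lt0 (i := j) (rootp_s b1 (rootp_sroot i))).
  rewrite /sX rcoefB ?rcoefZ ?rcoef_sroot //; [|exact: inQ_sroot|exact: inQZ].
  by rewrite eq_sym (negbTE ji) sub0r oppr_lt0 mulr_gt0.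
by rewrite size_map; apply: leq_trans (size_filter_neq iL) _.
Qed.

(* Along an infinite ascending path, a family of sets that is transported by the
   simple reflections and gains the fired simple root at each step strictly grows. *)
Lemma growing_family (it : nat -> idx D) (Q : nat -> Xt D -> Prop) :
  (forall t e, Q t e -> nonneg e) ->
  (forall t e, Q t e -> Q t.+1 (rX (it t) e)) ->
  (forall t, Q t.+1 (sroot (it t))) ->
  (forall t, exists L : seq (Xt D), forall e, Q t e -> e \in L) ->
  forall s t, (s < t)%N -> ~ (forall e, Q t e -> Q s e).
Proof.
move=> Qpos QS Qnew Qfin s t st QQ.
have step u n : (exists S : seq (Xt D), [/\ uniq S, size S = n & forall e, e \in S -> Q u e]) ->
    exists S : seq (Xt D), [/\ uniq S, size S = n.+1 & forall e, e \in S -> Q u.+1 e].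
  case=> S [uS sS SQ]; exists (sroot (it u) :: [seq rX (it u) e | e <- S]); split=> /=.
  - rewrite map_inj_uniq ?uS ?andbT; last exact: can_inj (rXK _).
    by apply/mapP => -[e /SQ /Qpos e0 /esym]; apply: nonneg_neq_opp.
  - by rewrite size_map sS.
  - move=> e; rewrite inE => /orP[/eqP->|]; first exact: Qnew.
    by case/mapP => e' /SQ e'Q ->; apply: QS.
have steps d n : (exists S : seq (Xt D), [/\ uniq S, size S = n & forall e, e \in S -> Q s e]) ->
    exists S : seq (Xt D), [/\ uniq S, size S = (d + n)%N & forall e, e \in S -> Q (d + s)%N e].
  by move=> H; elim: d => // d IHd; apply: step.
(* Transport from [s] to [t] gains [t - s] elements, and the assumed inclusion brings them back to
   [Q s]; repeating this makes the finite set [Q s] arbitrarily large. *)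
have all n : exists S : seq (Xt D), [/\ uniq S, (n <= size S)%N & forall e, e \in S -> Q s e].
  elim: n => [|n [S [uS sS SQ]]]; first by exists [::].
  have [|S' [uS' sS' SQ']] := steps (t - s)%N (size S); first by exists S.
  exists S'; split=> //; first by rewrite sS'; lia.
  by move=> e /SQ'; rewrite subnK ?(ltnW st) // => /QQ.
have [L LP] := Qfin s; have [S [uS sS SQ]] := all (size L).+1.
have /(leq_trans sS) := uniq_leq_size uS (fun e eS => LP e (SQ e eS)).
by rewrite ltnn.
Qed.

End Depth.

(** * Infinite ascending paths *)

Section Ascent.
Variable D : KMRootDatum.
Implicit Types (i j : idx D) (e : Xt D) (b c : Xt D * Yt D).
Implicit Types (p : nat -> Xt D * Yt D) (it : nat -> idx D).

(** The candidates for the finite part of [d], up to the action of [u]; the bound 2 leaves room for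
    a suitable level, see [level_between]. *)
Definition refl_inv2 b e := [/\ refl_inv b e, e <> b.1 & 2 <= pairing b.2 e].

(** Expresses that there are at least [n] such roots. *)
Definition refl_inv2_size b n :=
  exists S : seq (Xt D), [/\ uniq S, size S = n & forall e, e \in S -> refl_inv2 b e].

Lemma refl_inv2_child i b e : posp b -> asc i b -> refl_inv2 b e -> refl_inv2 (child i b) (rX i e).
Proof.
move=> bp bi [e1 e2 e3]; split; first exact: refl_inv_child.
  by move=> /(can_inj (rXK i)).
by rewrite pairing_child.
Qed.

Lemma refl_inv2_size_child i b n : posp b -> asc i b ->
  refl_inv2_size b n -> refl_inv2_size (child i b) n.
Proof.
move=> bp bi [S [uS sS SP]]; exists [seq rX i e | e <- S]; split.
- by rewrite map_inj_uniq //; apply: can_inj (rXK i).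
- by rewrite size_map.
- by move=> e /mapP[e' /SP e'P ->]; apply: refl_inv2_child.
Qed.

(** The new element is [alpha_i]: its pairing with the coroot changes sign and becomes at least
    2. *)
Lemma refl_inv2_size_childS i b n : posp b -> pairing b.2 (sroot i) <= - 2 ->
  refl_inv2_size b n -> refl_inv2_size (child i b) n.+1.
Proof.
move=> bp bi2 [S [uS sS SP]].
have bi : asc i b by rewrite /asc; lia.
exists (sroot i :: [seq rX i e | e <- S]); split=> /=.
- rewrite map_inj_uniq ?uS ?andbT; last exact: can_inj (rXK i).
  apply/mapP => -[e /SP[[_ [e0 _]] _ _] /esym]; exact: nonneg_neq_opp.
- by rewrite size_map sS.
- move=> e; rewrite inE => /orP[/eqP->|/mapP[e' /SP e'P ->]]; last exact: refl_inv2_child.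
  split; first exact: refl_inv_new.
    by move=> /= /esym; apply: nonneg_neq_opp; case: bp.
  by rewrite pairing_child_sroot; lia.
Qed.

Definition ascending p it :=
  forall t, [/\ posp (p t), asc (it t) (p t) & p t.+1 = child (it t) (p t)].

Definition fired it j := exists t, j = it t.

Section Steady.
Variables (p : nat -> Xt D * Yt D) (it : nat -> idx D).
Hypothesis pit : ascending p it.
Hypothesis steady : forall t, pairing (p t).2 (sroot (it t)) = - 1.

Lemma steadyS t j :
  pairing (p t.+1).2 (sroot j) = pairing (p t).2 (sroot j) + pairing (scoroot (it t)) (sroot j).
Proof.
have [_ _ ->] := pit t; rewrite /= /rY pairingBl pairingZl steady; ring.
Qed.

(** Firing [j] turns the value -1 into 1, and firing any other index does not increase the value at
    [j]. *)
Lemma steady_ub t j : pairing (p t).2 (sroot j) <= Num.max (pairing (p 0).2 (sroot j)) 1.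
Proof.
elim: t => [|t IHt]; first by rewrite le_max lexx.
rewrite steadyS; have [->|ne] := eqVneq j (it t).
  by rewrite steady cartan_diag le_max lexx orbT.
by apply: le_trans IHt; rewrite gerDl cartan_offdiag // eq_sym.
Qed.

Lemma coef_not_fired t j : ~ fired it j -> rcoef (p t).1 j = rcoef (p 0).1 j.
Proof.
move=> nj; elim: t => // t <-; have [[b1 _] _ ->] := pit t.
rewrite /= /rX rcoefB ?rcoefZ ?rcoef_sroot; first last.
- by apply: inQZ; apply: inQ_sroot.
- exact: rootp_inQ b1.
- exact: inQ_sroot.
have [e|] := eqVneq (it t) j; last by rewrite mulr0 subr0.
by case: nj; exists t.
Qed.

Lemma pairing_fired s t e :
  (forall j, fired it j -> pairing (p s).2 (sroot j) = pairing (p t).2 (sroot j)) ->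
  inQ e -> (forall j, ~ fired it j -> rcoef e j = 0) ->
  pairing (p s).2 e = pairing (p t).2 e.
Proof.
move=> st Qe e0; rewrite (rcoefE Qe) !pairing_sumr; apply: eq_bigr => j _.
rewrite !pairingZr; have [/st->//|/e0 ->] := classic (fired it j).
by rewrite !mul0r.
Qed.

Hypothesis lb : forall t j, fired it j -> -1 <= pairing (p t).2 (sroot j).

(** Pigeonhole on the vector of values, shifted by 1 to be natural on fired indices. At other
    indices [inord] may truncate, but only fired ones are compared. *)
Lemma steady_recurrent : exists P : nat -> Prop,
  (forall n, exists2 t, (n <= t)%N & P t) /\
  forall s t, P s -> P t ->
    forall j, fired it j -> pairing (p s).2 (sroot j) = pairing (p t).2 (sroot j).
Proof.
pose ub j : int := Num.max (pairing (p 0).2 (sroot j)) 1.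
pose N := \max_j `|(ub j + 1)%R|%N.
pose v t j : nat := `|(pairing (p t).2 (sroot j) + 1)%R|%N.
pose f t : {ffun idx D -> 'I_N.+1} := [ffun j => inord (v t j)].
have [V VP] := infinite_pigeonhole f.
exists (fun t => f t = V); split=> [n|s t es et j jF]; first by have [t] := VP n; exists t.
have : f s j = f t j by rewrite es et.
have vle u : (v u j <= N)%N.
  apply: leq_trans (@leq_bigmax _ (fun j => `|(ub j + 1)%R|%N) j).
  by have := steady_ub u j; have := lb u jF; rewrite /v -/(ub j); lia.
rewrite !ffunE => /(congr1 val); rewrite /= !inordK ?ltnS //.
by rewrite /v; have := lb s jF; have := lb t jF; lia.
Qed.

(** [Q t] consists of the positive roots supported on fired indices that pair positively with the
    coroot. A nonzero coordinate at an unfired [j] is constant and positive, so all of [Q t] is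
    inverted and [Q t] is finite. Then [Q] strictly grows, yet it depends only on the recurring
    values. *)
Lemma steady_fired_support : forall j, ~ fired it j -> rcoef (p 0).1 j = 0.
Proof.
move=> j nj; apply: NNPP => cj.
have [P [Pinf PE]] := steady_recurrent.
have [s _ Ps] := Pinf 0%N; have [t st Pt] := Pinf s.+1.
pose Q t e := [/\ nonneg e, exists k, rootp e k,
  forall j, ~ fired it j -> rcoef e j = 0 & 0 < pairing (p t).2 e].
apply: (@growing_family D it Q _ _ _ _ s t st).
- by move=> u e [].
- move=> u e [e0 [k ek] supp pe]; have [bp ba pS] := pit u.
  have ne : e <> sroot (it u) by move=> e'; move: ba pe; rewrite e' /asc; lia.
  split; [exact: (rX_nonneg ek) | by exists (rY (it u) k); apply: rootp_r | |].
    move=> l nl; rewrite /rX rcoefB ?rcoefZ ?rcoef_sroot; first last.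
    + by apply: inQZ; apply: inQ_sroot.
    + exact: rootp_inQ ek.
    + exact: inQ_sroot.
    rewrite supp // sub0r; have [e'|] := eqVneq (it u) l; last by rewrite mulr0 oppr0.
    by case: nl; exists u.
  by rewrite pS pairing_child.
- move=> u; have [bp ba pS] := pit u; split; first exact: nonneg_sroot.
  + by exists (scoroot (it u)); apply: rootp_sroot.
  + move=> l nl; rewrite rcoef_sroot; have [e'|//] := eqVneq (it u) l.
    by case: nl; exists u.
  + by rewrite pS pairing_child_sroot oppr_gt0.
- move=> u; have [[b1 b2] _ _] := pit u; have [L LP] := refl_inv_finite b1; exists L.
  move=> e [e0 [k ek] supp pe]; apply: LP; split; [by exists k | split=> //].
  apply: (rootp_coef_lt0 (i := j) (rootp_s b1 ek)).
  rewrite /sX rcoefB ?rcoefZ; first last.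
  + by apply: inQZ; apply: rootp_inQ b1.
  + exact: rootp_inQ ek.
  + exact: rootp_inQ b1.
  rewrite supp // sub0r oppr_lt0 mulr_gt0 // lt_def coef_not_fired //.
  rewrite (introN eqP cj) -(coef_not_fired u nj).
  by case/nonnegP: b2 => _ ->.
- move=> e [e0 ek supp pe]; split=> //.
  rewrite (@pairing_fired s t) //; last by case: ek => k /rootp_inQ.
  exact: PE _ _ Ps Pt.
Qed.

(** The inversion sets of the reflections strictly grow along the path. *)
Lemma steady_inj s t : (s < t)%N -> (p s).1 <> (p t).1.
Proof.
move=> st e; have [[s1 _] _ _] := pit s; have [[t1 _] _ _] := pit t.
have e2 : (p s).2 = (p t).2 by rewrite e in s1; apply: rootp_inj s1 t1.
apply: (@growing_family D it (fun t => refl_inv (p t)) _ _ _ _ s t st).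
- by move=> u x [_ []].
- by move=> u x; have [bp ba ->] := pit u; apply: refl_inv_child.
- by move=> u; have [bp ba ->] := pit u; apply: refl_inv_new.
- by move=> u; have [[b1 _] _ _] := pit u; apply: refl_inv_finite.
- by move=> x; rewrite /refl_inv e e2.
Qed.

(* The roots at two times with the same values pair to 2 both ways, so one of
   them lies in [refl_inv2] of the other. *)
Lemma steady_inv2 n : exists t, refl_inv2_size (p t) n.
Proof.
have supp := steady_fired_support.
have [P [Pinf PE]] := steady_recurrent.
have times N m : exists T : seq nat, [/\ uniq T, size T = N & forall t, t \in T -> P t /\ (m <= t)%N].
  elim: N => [|N [T [uT sT TP]]]; first by exists [::].
  have [t Tt Pt] := Pinf (maxn m (\max_(u <- T) u).+1).
  exists (t :: T); split=> /=; rewrite ?sT //.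
    rewrite uT andbT; apply/negP => tT.
    move: Tt; rewrite geq_max => /andP[_ lt_maxt].
    by have := leq_trans lt_maxt (@leq_bigmax_seq _ T xpredT id t tT isT); rewrite ltnn.
  move=> u; rewrite inE => /orP[/eqP->|/TP//]; split=> //.
  by move: Tt; rewrite geq_max => /andP[].
have pinj s t : (p s).1 = (p t).1 -> s = t.
  have [st|ts|//] := ltngtP s t => e; first by case: (steady_inj st).
  by case: (steady_inj ts).
have [T [uT sT TP]] := times n 0%N.
have [L LP] : exists L : seq (Xt D), forall t, t \in T -> forall e, refl_inv (p t) e -> e \in L.
  elim: (T) => [|t T' [L LP]]; first by exists [::].
  have [[b1 _] _ _] := pit t; have [L' LP'] := refl_inv_finite b1; exists (L' ++ L) => u.
  rewrite inE => /orP[/eqP->|uT'] e ie; rewrite mem_cat; first by rewrite LP'.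
  by rewrite (LP _ uT') ?orbT.
(* Infinitely many times have distinct roots, so one of these roots is inverted by none of the
   reflections at times in [T]. *)
have [t [Pt tT tL]] : exists t, [/\ P t, t \notin T & (p t).1 \notin L].
  apply: NNPP => no.
  have [T' [uT' sT' TP']] := times (size L).+1 (\max_(u <- T) u).+1.
  have : (size [seq (p t).1 | t <- T'] <= size L)%N.
    apply: uniq_leq_size; first by rewrite map_inj_uniq //; exact: pinj.
    move=> e /mapP[t /TP'[Pt tm] ->]; apply/negP => /negP tL; apply: no; exists t; split=> //.
    apply/negP => tT; have := @leq_bigmax_seq _ T xpredT id t tT isT.
    by move=> /(leq_trans tm); rewrite ltnn.
  by rewrite size_map sT' ltnn.
exists t, [seq (p s).1 | s <- T]; split; [by rewrite map_inj_uniq //; exact: pinj | by rewrite size_map |].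
move=> e /mapP[s sT' ->]; have [Ps _] := TP s sT'.
have [[s1 s2] _ _] := pit s; have [[t1 t2] _ _] := pit t.
have suppu u : forall j, ~ fired it j -> rcoef (p u).1 j = 0.
  by move=> j nj; rewrite coef_not_fired ?supp.
have ets : pairing (p t).2 (p s).1 = 2.
  rewrite -(rootp_pairing s1); apply: pairing_fired (rootp_inQ s1) (suppu s).
  exact: PE _ _ Pt Ps.
have est : pairing (p s).2 (p t).1 = 2.
  rewrite -(rootp_pairing t1); apply: pairing_fired (rootp_inQ t1) (suppu t).
  exact: PE _ _ Ps Pt.
split; last by rewrite ets.
  split; [by exists (p s).2 | split=> //].
  case: (rootp_or (rootp_s t1 s1)) => // pos.
  case/negP: tL; apply: (LP s sT'); split; [by exists (p t).2 | split=> //].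
  (* With both pairings equal to 2, the sides are [2 beta_s - beta_t] and
     [(beta_s - 2 beta_t) + (beta_s + beta_t)]: if [beta_s] is not inverted at time [t], then
     [beta_t] is inverted at time [s]. *)
  have -> : - sX (p s).1 (p s).2 (p t).1 = sX (p t).1 (p t).2 (p s).1 + ((p s).1 + (p t).1).
    by rewrite /sX ets est; rowring.
  by apply: nonnegD => //; apply: nonnegD.
by move=> /pinj st; rewrite -st sT' in tT.
Qed.

End Steady.
End Ascent.

(** * Finiteness of the roots with few candidates *)

Section Koenig.
Variable D : KMRootDatum.
Implicit Types (i j : idx D) (e : Xt D) (b c : Xt D * Yt D).
Implicit Types (p : nat -> Xt D * Yt D) (it : nat -> idx D).

Lemma ascending_shift p it T :
  ascending p it -> ascending (fun t => p (T + t)%N) (fun t => it (T + t)%N).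
Proof. by move=> pit t; rewrite addnS; apply: pit. Qed.

(** A pairing of at most -2 raises the count, so it occurs finitely often and the path becomes
    steady. From then on, a value below -1 at [j] can only decrease, and [j] is never fired again.
    After a further shift, fired indices keep values at least -1 and [steady_inv2] applies. *)
Lemma ascending_unbounded p it K : ascending p it ->
  ~ (forall t n, refl_inv2_size (p t) n -> (n <= K)%N).
Proof.
move=> pit bd.
have mono t d n : refl_inv2_size (p t) n -> refl_inv2_size (p (d + t)%N) n.
  move=> H; elim: d => // d IHd; have [bp ba] := pit (d + t)%N.
  by rewrite addSn => ->; apply: refl_inv2_size_child.
have [T0 steady0] : exists T0, forall t, (T0 <= t)%N -> pairing (p t).2 (sroot (it t)) = -1.
  have H f t n : refl_inv2_size (p t) n -> (K < n + f)%N ->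
      exists T0, forall t, (T0 <= t)%N -> pairing (p t).2 (sroot (it t)) = -1.
    elim: f t n => [|f IHf] t n tn lt_K; first by have := bd _ _ tn; move: lt_K; lia.
    have [[u [tu le2]]|no] := classic (exists u, (t <= u)%N /\ pairing (p u).2 (sroot (it u)) <= -2).
      apply: (IHf u.+1 n.+1); last by move: lt_K; lia.
      have [bp _ ->] := pit u; apply: refl_inv2_size_childS => //.
      by rewrite -(subnK tu); apply: mono.
    exists t => u tu; have [_ + _] := pit u; rewrite /asc.
    have := not_ex_all_not _ _ no u; lia.
  by apply: (H K.+1 0%N 0%N) => //; exists [::].
have qit := ascending_shift T0 pit.
set q := (fun t => p _) in qit; set jt := (fun t => it _) in qit.
have qsteady t : pairing (q t).2 (sroot (jt t)) = -1 by apply: steady0; rewrite leq_addr.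
have /fin_all_exists[T TP] : forall j, exists T, (forall t, -1 <= pairing (q t).2 (sroot j)) \/
    forall t, (T <= t)%N -> jt t <> j.
  move=> j; have [?|/not_all_ex_not[t /negP lt]] := classic (forall t, -1 <= pairing (q t).2 (sroot j)).
    by exists 0%N; left.
  exists t; right => u tu.
  have le2 : pairing (q u).2 (sroot j) <= -2.
    rewrite -(subnK tu); elim: (u - t)%N => [|d IHd]; first by rewrite add0n; move: lt; rewrite -ltNge; lia.
    have ne : jt (d + t)%N != j by apply/eqP => e; move: IHd; rewrite -e qsteady.
    by rewrite addSn (steadyS qit qsteady); have := cartan_offdiag ne; move: IHd; lia.
  by move=> e; move: le2; rewrite -e qsteady.
pose M := \max_j T j.
have rit := ascending_shift M qit.
have [] := @steady_inv2 _ _ _ rit _ _ K.+1.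
- by move=> t; apply: qsteady.
- move=> t j [u ju]; case: (TP j) => [H|H]; first exact: H.
  case: (H (M + u)%N) => //; apply: leq_trans (leq_addr _ _); exact: leq_bigmax.
- by move=> t /bd; rewrite ltnn.
Qed.

Inductive desc b : Xt D * Yt D -> Prop :=
| desc_refl : desc b b
| desc_child i c : asc i b -> desc (child i b) c -> desc b c.

Lemma desc_rcons b c i : desc b c -> asc i c -> desc b (child i c).
Proof.
elim=> [{b c} c|{b c} b j c bj _ IH] ci.
- by apply: (desc_child ci); apply: desc_refl.
- by apply: (desc_child bj); apply: IH.
Qed.

(* Koenig's lemma on the tree of ascents. *)
Lemma refl_inv2_bounded_finite K : exists L : seq (Xt D), forall b, posp b ->
  (forall n, refl_inv2_size b n -> (n <= K)%N) -> b.1 \in L.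
Proof.
pose small b := forall n, refl_inv2_size b n -> (n <= K)%N.
pose fin b := exists L : seq (Xt D), forall c, desc b c -> small c -> c.1 \in L.
have finS b : (forall i, asc i b -> fin (child i b)) -> fin b.
  move=> H; have /fin_all_exists[L LP] : forall i, exists L : seq (Xt D),
      asc i b -> forall c, desc (child i b) c -> small c -> c.1 \in L.
    move=> i; have [/H[L LP]|] := classic (asc i b); first by exists L.
    by exists [::].
  exists (b.1 :: flatten [seq L i | i : idx D]) => c; case=> [|i {}c bi bc] cs.
    by rewrite inE eqxx.
  rewrite inE; apply/orP; right; apply/flattenP; exists (L i); first exact: codom_f.
  exact: LP bc cs.
have fin_sroot i : fin (sroot i, scoroot i).
  apply: NNPP => nfin.
  pose good b := posp b /\ ~ fin b.
  have nextP b : good b -> exists i, asc i b /\ good (child i b).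
    case=> bp nb; apply: NNPP => no; apply: nb; apply: finS => j bj.
    apply: NNPP => nc; apply: no; exists j; split=> //; split=> //.
    exact: posp_child.
  pose next b := epsilon (inhabits i) (fun i => asc i b /\ good (child i b)).
  have {}nextP b : good b -> asc (next b) b /\ good (child (next b) b).
    by move=> /nextP; apply: epsilon_spec.
  pose p := fix p t := if t is t'.+1 then child (next (p t')) (p t') else (sroot i, scoroot i).
  have pgood t : good (p t).
    elim: t => [|t IHt] /=; last by case: (nextP _ IHt).
    by split=> //; split; [apply: rootp_sroot | apply: nonneg_sroot].
  apply: (@ascending_unbounded p (fun t => next (p t)) K).
    by move=> t; split=> //; [case: (pgood t) | case: (nextP _ (pgood t))].
  move=> t n tn.
  (* A node whose small descendants are not confined to a finite list has at least one, and counts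
     do not decrease on the way to it; so the node itself is small. *)
  have [c [bc cs]] : exists c, desc (p t) c /\ small c.
    apply: NNPP => no; case: (pgood t) => _; apply; exists [::] => c bc cs.
    by case: no; exists c.
  apply: cs; have [bp _] := pgood t.
  elim: bc bp tn => // b j c' bj _ IH bp bn; apply: IH; first exact: posp_child.
  exact: refl_inv2_size_child.
have /fin_all_exists[L LP] := fin_sroot.
exists (flatten [seq L i | i : idx D]) => b bp bs.
have [i bi] : exists i, desc (sroot i, scoroot i) b.
  move: b bp {bs}; apply: posp_induction => [i|i b bp bi [j bj]].
    by exists i; apply: desc_refl.
  by exists j; apply: desc_rcons.
apply/flattenP; exists (L i); first exact: codom_f.
exact: LP bi bs.
Qed.

End Koenig.

(** At most [size B] elements of [S] lie in [B], and at most as many are sent into [B] by [f]. *)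
Lemma uniq_escape (T : eqType) (f : T -> T) (S B : seq T) :
  injective f -> uniq S -> (size B * 2 < size S)%N ->
  exists e, [/\ e \in S, e \notin B & f e \notin B].
Proof.
move=> fI uS lt; apply: NNPP => no.
have H (p : pred T) (g : T -> T) : injective g -> (forall e, e \in S -> p e -> g e \in B) ->
    (count p S <= size B)%N.
  move=> gI pB; rewrite -size_filter -(size_map g).
  apply: uniq_leq_size; first by rewrite map_inj_uniq ?filter_uniq.
  by move=> e' /mapP[e]; rewrite mem_filter => /andP[pe eS] ->; apply: pB.
have h1 := H (fun e => e \in B) id (fun _ _ => id) (fun e _ => id).
have h2 := H (fun e => f e \in B) f fI (fun e _ => id).
have : (size S <= count (fun e => e \in B) S + count (fun e => f e \in B) S)%N.
  rewrite -count_predUI; apply: leq_trans (leq_addr _ _).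
  rewrite leq_eqVlt eq_sym -all_count; apply/orP; left; apply/allP => e eS /=.
  by apply: contra_notT no; rewrite negb_or => /andP[? ?]; exists e.
by move: lt h1 h2; lia.
Qed.

(** Meant for [N = <nu, beta>], [P = <nu, alpha>] and [c = <beta^vee, alpha>]. The first two bounds
    make the levels [n] of [d] and [c * m - n] of [d''] nonnegative; the last two put them below [P]
    and [c * N - P], so that [y^-1] makes both negative. *)
Lemma level_between (c N m P : int) :
  0 < P -> 0 < c * N - P -> 2 <= c -> 0 <= m -> m < N ->
  exists n, [/\ 0 <= n, n <= c * m, n < P & P - c * (N - m) < n].
Proof.
move=> P0 NP c2 m0 mN; exists (Num.max 0 (P - c * (N - m) + 1)).
have ? : 0 <= c * m by rewrite mulr_ge0 //; lia.
have ? : 2 * 1 <= c * (N - m) by rewrite ler_pM //; lia.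
by rewrite mulrBr in NP *; split; lia.
Qed.

(** * Finiteness of the set of co-covers *)

Section Cocovers.
Variable D : KMRootDatum.
Implicit Types (g d e : Xt D) (h k lam mu nu : Yt D) (m n : int) (x y z : aff D).
Implicit Types (s t u v w : word D).

Lemma rootp_multiple g h g' h' (k c : int) : rootp g h -> rootp g' h' -> k != 0 ->
  k *: g = c *: g' -> g = g' \/ g = - g'.
Proof.
move=> gh [s [i [-> _]]] k0 e; have rg := rootp_act (rev s) gh.
have [|H|H] := @rootp_multiple_sroot _ _ _ i k c rg k0.
- by rewrite -actXZ e actXZ actX_revK.
- by left; rewrite -H actX_Krev.
- by right; rewrite -actXN -H actX_Krev.
Qed.

Lemma actX_rev_weq s t : weq s t -> forall e, actX (rev s) e = actX (rev t) e.
Proof. by move=> [st _] e; apply: (@actX_inj _ s); rewrite actX_Krev st actX_Krev. Qed.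

Lemma isrefl_uniq g h m z z' y : isrefl g h m z y -> isrefl g h m z' y -> aeq z z'.
Proof.
move=> [z1 z2] [z1' z2']; split; first by rewrite z1 z1'.
by apply: weqX => u; rewrite z2 z2'.
Qed.

Definition step z y := inWplus y /\
  exists g h m, [/\ rootp g h, ap g m, ~ iap y g m & isrefl g h m z y].

Lemma bstep_step z y : bstep z y -> step z y.
Proof.
case=> yW [_ [v [i [m [a [ia [e1 e2]]]]]]]; split=> //.
have gh : rootp (actX v (sroot i)) (actY v (scoroot i)) by exists v, i.
exists (actX v (sroot i)), (actY v (scoroot i)), m; split=> //.
- exact/(pos_aff_rootP _ gh).
- rewrite /aff_act /aff_inv /= pairingNl pairing_act in ia.
  by rewrite (pos_aff_rootP _ (rootp_iact y gh)) in ia.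
- split; first by rewrite e1 /= actY_refl.
  by move=> x; rewrite (proj1 e2) /= actX_cat actX_refl.
Qed.

Lemma step_aeqr z y y' : step z y -> aeq y y' -> step z y'.
Proof.
case=> yW [g [h [m [gh ag iag [z1 z2]]]]] [e1 e2]; split; first by rewrite /inWplus -e1.
exists g, h, m; split=> //.
  by rewrite /iap -e1 -(actX_rev_weq e2).
by split=> [|u]; rewrite -?e1 // z2 (proj1 e2).
Qed.

(** Steps of the closure that only change the representing word are absorbed into the preceding
    reflection. *)
Lemma ble_last x y : ble x y -> aeq x y \/ exists2 z, ble x z & step z y.
Proof.
move=> /clos_rt_rtn1_iff; elim=> [|b c bc xb IH]; first by left.
case: bc => [bc|/bstep_step bc]; last first.
  by right; exists b => //; apply/clos_rt_rtn1_iff.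
case: IH => [xb'|[z xz zb]]; last by right; exists z => //; apply: step_aeqr bc.
left; case: xb' bc => e1 e2 [e1' e2']; split; first by rewrite e1.
exact: weq_trans e2'.
Qed.

(** If the last step of a chain started at an element other than [x], that element would lie
    strictly between. *)
Lemma cocover_step x y : cocover x y -> step x y /\ ~ has_between x y.
Proof.
case=> [[xy nxy] nb]; split=> //; have [//|[z xz zy]] := ble_last xy.
have [yW [g [h [m [gh ag iag zP]]]]] := zy.
have [[e1 e2]|nxz] := classic (aeq x z).
  split=> //; exists g, h, m; split=> //; case: zP => z1 z2.
  by split=> [|u]; rewrite ?e1 // (proj1 e2) z2.
case: nb; exists z; split; split=> //.
  by have [_ /ble_bstep] := bstep_isrefl gh zP yW ag iag.
exact: isrefl_not_aeq zP.
Qed.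

Lemma ap_ge0 g m : ap g m -> 0 <= m.
Proof. by case=> [/ltW|[->]]. Qed.

Lemma niap_le y g m : ~ iap y g m -> m <= pairing y.1 g.
Proof. by move=> na; rewrite leNgt; apply/negP => lt; apply: na; left; rewrite subr_gt0. Qed.

Lemma isrefl_finite y (E : seq (Xt D)) : exists L : seq (aff D), forall g h m x,
  rootp g h -> g \in E -> 0 <= m <= pairing y.1 g -> isrefl g h m x y ->
  exists2 x', x' \in L & aeq x x'.
Proof.
elim: E => [|g E [L LP]]; first by exists [::].
have [[h gh]|no] := classic (exists h, rootp g h); last first.
  exists L => g' h' m x gh'; rewrite inE => /orP[/eqP e|]; last exact: LP gh'.
  by case: no; exists h'; rewrite -e.
pose zf m := epsilon (inhabits y) (fun z => isrefl g h m z y).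
have zfP m : isrefl g h m (zf m) y by apply: (epsilon_spec (inhabits y) _ (isrefl_ex m y gh)).
exists ([seq zf (Posz a) | a <- iota 0 `|pairing y.1 g|.+1] ++ L) => g' h' m x gh'.
rewrite inE => /orP[/eqP e /andP[m0 mN] xP|gE mb xP]; last first.
  by have [x' x'L xx'] := LP _ _ _ _ gh' gE mb xP; exists x'; rewrite ?mem_cat ?x'L ?orbT.
rewrite e in gh' mN xP; have hh := rootp_inj gh gh'; rewrite -hh in xP.
exists (zf m); last exact: isrefl_uniq xP (zfP m).
rewrite mem_cat; apply/orP; left; apply/mapP; exists `|m|%N; last by rewrite gez0_abs.
by rewrite mem_iota; lia.
Qed.

Lemma finitely_many_cocovers_of_roots y (E : seq (Xt D)) :
  (forall x g h m, cocover x y -> rootp g h -> ap g m -> ~ iap y g m ->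
     isrefl g h m x y -> g \in E) ->
  finitely_many_cocovers y.
Proof.
move=> EP; have [L LP] := isrefl_finite y E; exists L => x xy.
have [[yW [g [h [m [gh ag iag xP]]]]] _] := cocover_step xy.
apply: (LP g h m x gh) => //; first exact: EP xy gh ag iag xP.
by rewrite (ap_ge0 ag) niap_le.
Qed.

Lemma cocovers_Yin mu w : Yin mu -> finitely_many_cocovers (mu, w).
Proof.
move=> muY; have [E EP] := inversions_finite (rev w).
apply: (@finitely_many_cocovers_of_roots _ E) => x g h m _ gh ag iag _.
have mu0 : pairing mu g = 0.
  rewrite (rcoefE (rootp_inQ gh)) pairing_sumr big1 // => i _.
  by rewrite pairingZr muY mulr0.
have m0 : m = 0.
  have := ap_ge0 ag; have := niap_le iag; rewrite /= mu0.
  by move=> ? ?; apply/eqP; rewrite eq_le; apply/andP.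
have gpos : nonneg g by move: ag; rewrite m0 => -[|[]]; rewrite ?ltxx.
apply: (EP g h gh gpos) => wg; apply: iag; right.
by rewrite /= mu0 subr0.
Qed.

(** The reflection in such a root fixes [mu], and a reflection determines its root up to sign. *)
Lemma orthogonal_roots_finite mu : spherical mu -> exists Z : seq (Xt D),
  forall g h, rootp g h -> pairing mu g = 0 -> g \in Z.
Proof.
case=> L LP.
have [Z ZP] : exists Z : seq (Xt D), forall t, t \in L -> forall g h, rootp g h ->
    (forall e, actX t e = sX g h e) -> g \in Z.
  elim: (L) => [|t L' [Z ZP]]; first by exists [::].
  have [[g0 [h0 [gh0 t0]]]|no] := classic (exists g h, rootp g h /\ forall e, actX t e = sX g h e).
    exists [:: g0, - g0 & Z] => t'; rewrite inE => /orP[/eqP-> g h gh tg|t'L g h gh tg]; last first.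
      by rewrite !inE (ZP t' t'L g h) ?orbT.
    have e : (2 : int) *: g = pairing h0 g *: g0.
      have := tg g; rewrite t0 sX_self // /sX => e.
      rewrite -[RHS](subKr g) e opprK -[2]/(1 + 1 : int) scalerDl scale1r //.
    have [|->|->] := rootp_multiple gh gh0 _ e; rewrite ?inE ?eqxx ?orbT //.
  exists Z => t'; rewrite inE => /orP[/eqP-> g h gh tg|t'L g h gh tg]; last exact: (ZP t' t'L g h).
  by case: no; exists g, h.
exists Z => g h gh mu0; have [w [wX wY]] := rootp_word gh.
have [t tL [tX _]] : exists2 t, t \in L & weq w t.
  by apply: LP; rewrite wY /sY mu0 scale0r subr0.
by apply: (ZP t tL g h gh) => x; rewrite -tX wX.
Qed.

Lemma dominant_ge0 nu g : dominant nu -> nonneg g -> 0 <= pairing nu g.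
Proof.
move=> nu0 [c ->]; rewrite pairing_sumr sumr_ge0 // => i _.
by rewrite pairingZr mulr_ge0.
Qed.

Lemma dominant_gt0 nu g h : dominant nu -> rootp g h -> 0 < pairing nu g -> nonneg g.
Proof.
move=> nu0 gh lt; case: (rootp_or gh) => // /(dominant_ge0 nu0).
by rewrite pairingNr oppr_ge0 leNgt lt.
Qed.

Lemma cocovers_spherical mu w : inYplus mu -> spherical mu ->
  finitely_many_cocovers (mu, w).
Proof.
move=> muY /orthogonal_roots_finite[Z ZP].
have [u [nu [nu0 muE]]] := muY.
have munu e : pairing mu (actX u e) = pairing nu e by rewrite muE pairing_act.
have [Bu BuP] := inversions_finite u.
have [Bw BwP] := inversions_finite (rev w ++ u).
(* The roots to be avoided by [alpha] and [- s_beta alpha]: those inverted by [u] and those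
   orthogonal to [nu]. The factor 2 below is the one in [uniq_escape]. *)
pose B := Bu ++ [seq actX (rev u) e | e <- Z].
have [Lq LqP] := @refl_inv2_bounded_finite D (size B * 2).
have BP e k : rootp e k -> nonneg e -> e \notin B -> nonneg (actX u e) /\ 0 < pairing nu e.
  move=> ek e0; rewrite mem_cat negb_or => /andP[eBu eZ]; split.
    by apply: NNPP => ne; case/negP: eBu; apply: BuP ek e0 ne.
  rewrite lt_def dominant_ge0 // andbT; apply: contra eZ => /eqP nu_e.
  apply/mapP; exists (actX u e); last by rewrite actX_revK.
  by apply: (ZP _ _ (rootp_act u ek)); rewrite munu.
(* Outside [Z], [N > 0]; outside [Bw], [w^-1 gamma] is positive and [m < N]; outside [Lq], there are
   enough candidates [alpha]. *)
apply: (@finitely_many_cocovers_of_roots _ (Z ++ [seq actX u e | e <- Bu ++ Bw ++ Lq])).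
move=> x g h m xy gh ag iag xP; have [_ nb] := cocover_step xy.
apply: NNPP => /negP; rewrite mem_cat negb_or => /andP[gZ gE].
pose b := actX (rev u) g; pose bh := actY (rev u) h.
have bbh : rootp b bh := rootp_act (rev u) gh.
have gE' : g = actX u b by rewrite actX_Krev.
have hE' : h = actY u bh by rewrite actY_Krev.
have : b \notin Bu ++ Bw ++ Lq by apply: contra gE => bE; apply/mapP; exists b.
rewrite !mem_cat !negb_or => /and3P[bBu bBw bLq].
pose N := pairing nu b.
have muN : pairing mu g = N by rewrite gE' munu.
have m0 := ap_ge0 ag; have mN := niap_le iag; rewrite /= muN in mN.
have N0 : 0 < N.
  rewrite lt_def (le_trans m0 mN) andbT; apply: contra gZ => /eqP e.
  by apply: ZP gh _; rewrite muN.
have bpos : nonneg b := dominant_gt0 nu0 bbh N0.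
have wgpos : nonneg (actX (rev w) g).
  by apply: NNPP => ne; case/negP: bBw; apply: (BwP _ _ bbh bpos); rewrite actX_cat -gE'.
have ltmN : m < N.
  rewrite lt_def mN andbT; apply/eqP => e; apply: iag; right.
  by rewrite /= muN e subrr.
have [S [uS sS SP]] : exists S : seq (Xt D),
    [/\ uniq S, (size B * 2 < size S)%N & forall e, e \in S -> refl_inv2 (b, bh) e].
  apply: NNPP => no; case/negP: bLq; apply: (LqP (b, bh)) => // n [S [uS sS SP]].
  by rewrite leqNgt; apply/negP => lt; apply: no; exists S; rewrite sS.
have fI : injective (fun e => - sX b bh e) by move=> e e' /oppr_inj /(can_inj (sXK bbh)).
have [a [aS aB a'B]] := uniq_escape fI uS sS.
have [[[k ak] [a0 a'0]] ab c2] := SP a aS; rewrite /= in a'0 ab c2 a'B.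
have [ua nua] := BP _ _ ak a0 aB.
have [ua' nua'] := BP _ _ (rootpN (rootp_s bbh ak)) a'0 a'B.
pose c := pairing bh a.
have cE : pairing h (actX u a) = c by rewrite hE' pairing_act.
have a'E : - sX b bh a = c *: b - a by rewrite /sX opprB.
rewrite a'E actXB actXZ -gE' in ua'; rewrite a'E pairingBr pairingZr -/N in nua'.
have yW : inWplus (mu, w) by exact: muY.
have [n [n0 cm nlt ngt]] := level_between nua nua' c2 m0 ltmN.
have apge0 e l : nonneg e -> 0 <= l -> ap e l.
  by move=> e0; rewrite le0r => /orP[/eqP->|?]; [right | left].
have dgood : good (mu, w) g h m (actX u a) (actY u k) n.
  split; rewrite ?cE //.
  - exact: rootp_act.
  - split; first exact: apge0.
    by move=> /ap_ge0; rewrite /= munu subr_ge0 leNgt nlt.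
  - by apply: apge0 => //; rewrite subr_ge0.
  - move=> /ap_ge0; rewrite /= pairingBr pairingZr muN munu subr_ge0 leNgt.
    by rewrite ltrBlDr -ltrBlDl opprB addrCA -opprB -mulrBr ngt.
  - move=> e; have e2 : (2 : int) *: a = c *: b.
      apply: (@actX_inj _ u); rewrite !actXZ -gE' -e.
      by rewrite -[2]/(1 + 1 : int) scalerDl scale1r.
    have [//|//|aN] := rootp_multiple ak bbh _ e2.
    by apply: (rootp_notN bbh) => //; rewrite -aN.
(* Any good [d] has [<mu, d>] and [<mu, d''>] nonnegative. If one vanishes, [d] or [s_gamma d] lies
   in [Z]; otherwise [u^-1 d] and [u^-1 d''] are positive, so [u^-1 d] is an inversion of
   [s_beta]. *)
have [Lb LbP] := @refl_inv_finite D (b, bh) bbh.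
apply: nb; apply: (good_has_between (L := Z ++ [seq sX g h e | e <- Z] ++
  [seq actX u e | e <- Lb]) gh yW xP ag iag _ dgood).
move=> d l q [dl [apd iapd] apd'' iapd'' _].
have d_ge0 : 0 <= pairing mu d := le_trans (ap_ge0 apd) (niap_le iapd).
have d''_ge0 := le_trans (ap_ge0 apd'') (niap_le iapd''); rewrite /= in d''_ge0.
have e1 : actX u (actX (rev u) d) = d by rewrite actX_Krev.
have dr := rootp_act (rev u) dl; have sdr := rootp_s gh dl.
rewrite !mem_cat; have [d0|dn0] := eqVneq (pairing mu d) 0; first by rewrite (ZP d l).
have [d0|d''n0] := eqVneq (pairing mu (pairing h d *: g - d)) 0.
  apply/or3P; constructor 2; apply/mapP; exists (sX g h d); last by rewrite sXK.
  by apply: ZP sdr _; rewrite /sX -opprB pairingNr d0 oppr0.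
apply/or3P; constructor 3; apply/mapP; exists (actX (rev u) d) => //.
apply: LbP; split; first by exists (actY (rev u) l).
split; first by apply: dominant_gt0 nu0 dr _; rewrite -munu e1 lt_def dn0.
apply: (dominant_gt0 nu0 (rootpN (rootp_s bbh dr))).
rewrite /sX /= opprB -munu actXB actXZ -gE' e1.
have -> : pairing bh (actX (rev u) d) = pairing h d by rewrite -(pairing_act u) -hE' e1.
by rewrite lt_def d''n0.
Qed.

End Cocovers.

Theorem theorem3p6 (D : KMRootDatum) (mu : Yt D) (w : word D) :
  inYplus mu -> (spherical mu \/ Yin mu) ->
  finitely_many_cocovers (mu, w).
Proof.
move=> muY [mu_sph|mu_in]; first exact: cocovers_spherical.
exact: cocovers_Yin.
Qed.
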